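(* Let $\zeta\in\mathbb{C}\setminus[-1,1]$ and suppose that $\mu\in\mathcal{P}_m(\mu_T)$, where $\mu_T$ is the first kind Chebyshev measure. Let $Q_n$ be the polar polynomials, i.e. the polynomials of degree $n$ orthogonal with respect to $(\mathcal{L}_\zeta,\mu)$. Then the accumulation points of the zeros of $\{Q_n\}_{n=0}^{\infty}$ are located on the set $E=\mathcal{E}(\zeta)\cup[-1,1]$, where $\mathcal{E}(\zeta)$ is the ellipse $$\mathcal{E}(\zeta)=\{z\in\mathbb{C}: z=\cosh(\eta_\zeta+i\theta),\ 0\le\theta<2\pi\},\qquad \eta_\zeta=\ln|\varphi(\zeta)|=\ln|\zeta+\sqrt{\zeta^2-1}|.$$ If $\delta(\zeta)>2$, where $\delta(\zeta)=\min_{x\in[-1,1]}|\zeta-x|$, then one can take $E=\mathcal{E}(\zeta)$, i.e. the accumulation points of zeros are located on $\mathcal{E}(\zeta)$.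
   Context: $d\mu_T(x)=\frac{dx}{\sqrt{1-x^2}}$ on $[-1,1]$. $\mathcal{P}_m(\mu_T)$ is the class of finite positive Borel measures on $[-1,1]$ of the form $d\mu(x)=\frac{d\mu_T(x)}{\rho(x)}$ with $\rho(z)=r\prod_{i=1}^m(z-\nu_i)$ a polynomial nonnegative on $[-1,1]$. $\mathcal{L}_\zeta[f](x)=f(x)+(x-\zeta)f'(x)$. $Q_n$ is orthogonal with respect to $(\mathcal{L}_\zeta,\mu)$ if $\int\mathcal{L}_\zeta[Q_n](x)P(x)\,d\mu(x)=0$ for every polynomial $P$ with $\deg P\le n-1$ (this determines $Q_n$ of degree $n$ up to a constant factor). $\varphi(z)=z+\sqrt{z^2-1}$ with the branch such that $|\varphi(z)|>1$ for $z\in\mathbb{C}\setminus[-1,1]$. A point $z$ is an accumulation point of the zeros if it is the limit of a sequence of zeros of $Q_{n_k}$ for some $n_k\to\infty$. *)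

(* Defs.v *)
From HB Require Import structures.
From mathcomp Require Import all_boot all_order all_algebra.
From mathcomp Require Import complex.
From mathcomp Require Import all_classical all_reals all_analysis.
From mathcomp Require Import measurable_realfun.

Set Implicit Arguments.
Unset Strict Implicit.
Unset Printing Implicit Defensive.

Import Order.TTheory GRing.Theory Num.Theory.
Import numFieldNormedType.Exports.

Local Open Scope classical_set_scope.
Local Open Scope ring_scope.
Local Open Scope complex_scope.

Section ChebyshevMeasure.
Context {R : realType}.

(* At the endpoints the convention [0^-1 = 0] applies; this is harmless since
   [set -1; 1] is Lebesgue negligible. *)
Definition chebyshev_density (x : R) : R := (Num.sqrt (1 - x ^+ 2))^-1.

(* A measure on [-1, 1] is represented by a Borel measure on R that vanishes
   off [-1, 1]. *)
Definition chebyshev_measure (A : set (measurableTypeR R)) : \bar R :=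
  (\int[@lebesgue_measure R]_(x in A `&` `[(-1)%R, 1%R])
     (chebyshev_density x)%:E)%E.

Lemma chebyshev_density_ge0 (x : R) : 0 <= chebyshev_density x.
Proof. by rewrite invr_ge0 sqrtr_ge0. Qed.

Lemma measurable_chebyshev_density :
  measurable_fun (setT : set (measurableTypeR R)) chebyshev_density.
Proof.
have -> : chebyshev_density =
    (@powR R ^~ (-1)) \o (@Num.sqrt R \o (fun x => 1 - x ^+ 2)).
  by apply/funext => x /=; rewrite powR_inv1 ?sqrtr_ge0.
apply: measurableT_comp; first exact: measurable_powR.
apply: measurableT_comp.
  by apply: continuous_measurable_fun; exact: sqrt_continuous.
by apply: measurable_funB => //; exact: measurable_funX.
Qed.

Let chebyshev_measureE : chebyshev_measure = (fun A =>
  \int[@lebesgue_measure R]_(x in A)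
    ((EFin \o chebyshev_density) \_ `[(-1)%R, 1%R]) x)%E.
Proof. by apply/funext => A; rewrite /chebyshev_measure integral_mkcondr. Qed.

Let density_ge0 x :
  (0 <= ((EFin \o chebyshev_density) \_ `[(-1)%R, 1%R]) x)%E.
Proof.
by rewrite patchE; case: ifP => // _; rewrite lee_fin chebyshev_density_ge0.
Qed.

Let chebyshev_measure0 : chebyshev_measure set0 = 0%E.
Proof. by rewrite /chebyshev_measure set0I integral_set0. Qed.

Let chebyshev_measure_ge0 A : (0 <= chebyshev_measure A)%E.
Proof.
by apply: integral_ge0 => x _; rewrite lee_fin chebyshev_density_ge0.
Qed.

Let chebyshev_measure_sigma_additive : semi_sigma_additive chebyshev_measure.
Proof.
rewrite chebyshev_measureE.
apply: semi_sigma_additive_nng_induced; last exact: density_ge0.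
apply/(measurable_restrictT _ _).1 => //.
apply: measurable_funTS; apply/measurable_EFinP.
exact: measurable_chebyshev_density.
Qed.

HB.instance Definition _ := isMeasure.Build _ _ _ chebyshev_measure
  chebyshev_measure0 chebyshev_measure_ge0 chebyshev_measure_sigma_additive.

End ChebyshevMeasure.

Section PolarPolynomials.
Context {R : realType}.
Local Notation C := R[i].

(* The norm of [R[i]] takes its values in [R[i]]; this is the modulus as an
   element of [R]. *)
Definition cmod (z : C) : R := complex.Re `|z|.

Definition unit_segment : set C := [set x%:C | x in `[(-1 : R), 1]].

(* The order of [R[i]] makes [0 <= z] mean that [z] is real and nonnegative;
   the condition [r != 0] makes [rho] a polynomial of degree exactly [m].
   Zeros of [rho] on [-1, 1] are excluded by the finiteness of [mu]. *)
Definition chebyshev_class (m : nat)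
    (mu : {finite_measure set (measurableTypeR R) -> \bar R}) : Prop :=
  exists (r : C) (nu : 'I_m -> C),
    let rho : {poly C} := r *: \prod_(i < m) ('X - (nu i)%:P) in
    [/\ r != 0,
        forall x : R, x \in `[-1, 1] -> 0 <= rho.[x%:C] &
        forall A : set (measurableTypeR R), measurable A ->
          mu A = (\int[chebyshev_measure]_(x in A `&` `[(-1)%R, 1%R])
                   (complex.Re (rho.[x%:C]^-1))%:E)%E].

Definition cintegral (mu : {measure set (measurableTypeR R) -> \bar R})
    (D : set (measurableTypeR R)) (f : R -> C) : C :=
  (\int[mu]_(x in D) complex.Re (f x)) +i* (\int[mu]_(x in D) complex.Im (f x)).

Definition polar_op (zeta : C) (f : {poly C}) : {poly C} :=
  f + ('X - zeta%:P) * f^`().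

Definition polar_orthogonal (zeta : C)
    (mu : {measure set (measurableTypeR R) -> \bar R})
    (n : nat) (Q : {poly C}) : Prop :=
  forall P : {poly C}, (size P <= n)%N ->
    cintegral mu `[(-1)%R, 1%R]
      (fun x => (polar_op zeta Q).[x%:C] * P.[x%:C]) = 0.

(* The two determinations of [z + sqrt(z^2 - 1)] are inverse to each other and
   off [-1, 1] neither has modulus 1, so exactly one has modulus > 1. *)
Definition phi (z : C) : C :=
  let w := sqrtC (z ^+ 2 - 1) in
  if 1 < cmod (z + w) then z + w else z - w.

Definition cexp (z : C) : C :=
  (expR (complex.Re z))%:C * (cos (complex.Im z) +i* sin (complex.Im z)).

Definition ccosh (z : C) : C := (cexp z + cexp (- z)) / 2%:R.

Definition eta (zeta : C) : R := ln (cmod (phi zeta)).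

Definition ellipse (zeta : C) : set C :=
  [set ccosh (eta zeta +i* theta) | theta in `[(0 : R), 2 * pi[].

(* The infimum is attained, [-1, 1] being compact. *)
Definition dist_segment (zeta : C) : R :=
  inf [set cmod (zeta - x%:C) | x in `[(-1 : R), 1]].

Definition zero_accumulation (Q : nat -> {poly C}) : set C :=
  [set z | exists (n : nat -> nat) (w : nat -> C),
    [/\ n k @[k --> \oo] --> \oo,
        forall k, root (Q (n k)) (w k) &
        (w k : C^o) @[k --> \oo] --> (z : C^o)]].

End PolarPolynomials.

(* Main.v *)
Require Import Defs.
From HB Require Import structures.
From mathcomp Require Import all_boot all_order all_algebra.
From mathcomp Require Import complex polyrcf ring lra.
From mathcomp Require Import all_classical all_reals all_analysis.
From mathcomp Require Import measurable_realfun.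

(** Since [polar_op zeta f] is the derivative of [('X - zeta) f], orthogonality of
[Q n] says that this derivative is, up to a nonzero constant, the [n]-th
orthogonal polynomial of [mu]. If [F_n] is a primitive of that orthogonal
polynomial, every zero [z] of [Q n] satisfies [F_n(z) = F_n(zeta)]
([root_level]). The theorem is then a matter of comparing the sizes of [F_n]
at two points.

The orthogonal polynomials are explicit. Write each zero of [rho] as
[(a + a^-1) / 2] with [|a| < 1], let [T_i] be the Chebyshev polynomials
indexed by all integers ([T_(-i) = T_i]) and let [E] shift the index by one.
The three-term recurrence says that [(1 - a E) (1 - a E^-1)] acts on the
sequence [T] as multiplication by [-2a ('X - (a + a^-1) / 2)]. Put
[U_n = (prod_a (1 - a E^-1) T)_n], of degree [n] for large [n]. The
moments [u_i] of [U_i] against [mu] are bounded, and [prod_a (1 - a E)] sends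
them to a multiple of the integrals of [T_i] against the Chebyshev measure,
which vanish for [i > 0]. A bounded sequence killed by [1 - a E] with
[|a| < 1] is zero, hence [u_i = 0] for [i > 0]. As
[2 T_j U_n = U_(n+j) + U_(n-j)], [U_n] is orthogonal to [T_j] for [j < n]
([orthogonal_poly_proportional], [bernstein_szego]). Replacing [T] by its
primitives in the formula for [U_n] gives [F_n].

At [z = (w + w^-1) / 2] with [|w| >= r > 1] one has, uniformly,
[F_n(z) ~ (w^n / n) (w - w^-1) / 4 prod_a (1 - a / w)], with a nonvanishing
factor, whereas [|F_n(z)| <= K |w|^(n+1)] for all [|w| >= 1]. So [F_n] takes
different values, for large [n], at points whose [|w|] stay on two sides of a
gap ([prim_separation]). As [|phi zeta| > 1], a limit [z] of zeros must have
[|phi z| = |phi zeta|], which describes the ellipse; the points of the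
segment have [|phi z| = 1] and are excluded as well, so that both inclusions
come from the one into the ellipse.

On the measure side, three facts are used. A finite [mu] cannot have [rho]
vanishing in [[-1, 1]], because [1 / rho] would dominate a multiple of
[1 / |x - x0|] ([density_root_free]); this is what gives [|a| < 1].
A polynomial that is nonnegative on the segment and of integral zero vanishes
([integral_poly_eq0]); this makes orthogonal polynomials unique. Finally
[T_n(x) / sqrt(1 - x^2)] has the primitive [- U(x) sqrt(1 - x^2) / n], with
[U] the second kind polynomial of degree [n - 1], which vanishes at both ends
([integral_cheb_density]). *)

Set Implicit Arguments.
Unset Strict Implicit.
Unset Printing Implicit Defensive.

Import Order.TTheory GRing.Theory Num.Theory.
Import numFieldNormedType.Exports.

Local Open Scope classical_set_scope.
Local Open Scope ring_scope.
Local Open Scope complex_scope.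

(** * Modulus of a complex number *)

Section Modulus.
Context {R : realType}.
Implicit Types z w : R[i].

Lemma cmodE z : (cmod z)%:C = `|z|.
Proof. by rewrite /cmod normc_def. Qed.

Lemma cmod_ge0 z : 0 <= cmod z.
Proof. by rewrite -ler0c cmodE normr_ge0. Qed.

Lemma cmodM z w : cmod (z * w) = cmod z * cmod w.
Proof. by apply: complexI; rewrite rmorphM /= !cmodE normrM. Qed.

Lemma cmod1 : cmod (1 : R[i]) = 1.
Proof. by apply: complexI; rewrite cmodE normr1. Qed.

Lemma cmodV z : cmod z^-1 = (cmod z)^-1.
Proof. by apply: complexI; rewrite fmorphV /= !cmodE normfV. Qed.

Lemma cmodX z n : cmod (z ^+ n) = cmod z ^+ n.
Proof. by apply: complexI; rewrite rmorphXn /= !cmodE normrX. Qed.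

Lemma cmodN z : cmod (- z) = cmod z.
Proof. by apply: complexI; rewrite !cmodE normrN. Qed.

Lemma cmodD z w : cmod (z + w) <= cmod z + cmod w.
Proof. by rewrite -lecR rmorphD /= !cmodE ler_normD. Qed.

Lemma cmodB z w : cmod (z - w) <= cmod z + cmod w.
Proof. by rewrite -(cmodN w) cmodD. Qed.

Lemma cmod_triangle z w : cmod z - cmod w <= cmod (z + w).
Proof.
by rewrite lerBlDr -{1}(addrK w z) cmodB.
Qed.

Lemma cmod_eq0 z : (cmod z == 0) = (z == 0).
Proof. by rewrite -(inj_eq (@complexI R)) cmodE /= normr_eq0. Qed.

Lemma cmodR (x : R) : cmod x%:C = `|x|.
Proof. by rewrite /cmod normc_def /= expr0n addr0 sqrtr_sqr. Qed.

Lemma cmod_nat n : cmod (n%:R : R[i]) = n%:R.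
Proof. by apply: complexI; rewrite cmodE normr_nat rmorph_nat. Qed.

Lemma cmod_gt0 z : (0 < cmod z) = (z != 0).
Proof. by rewrite lt_def cmod_ge0 andbT cmod_eq0. Qed.

Lemma cmod_sqr z : cmod z ^+ 2 = complex.Re z ^+ 2 + complex.Im z ^+ 2.
Proof. by rewrite /cmod normc_def /= sqr_sqrtr // addr_ge0 ?sqr_ge0. Qed.

End Modulus.

(** * Chebyshev polynomials *)

Section Chebyshev.
Context {F : comNzRingType}.

(** The pair [(T_n, U_(n-1))], where [U] is of the second kind. Carrying both
makes the recursion of first order, being the addition formulas for
[cos] and [sin], and turns derivatives into a single induction. *)
Fixpoint cheb_pair n : {poly F} * {poly F} :=
  if n is k.+1 then
    let: (t, u) := cheb_pair k in
    ('X * t - (1 - 'X ^+ 2) * u, 'X * u + t)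
  else (1, 0).

Definition cheb_nat n := (cheb_pair n).1.
Definition cheb2 n := (cheb_pair n).2.

Lemma cheb_natS n :
  cheb_nat n.+1 = 'X * cheb_nat n - (1 - 'X ^+ 2) * cheb2 n.
Proof. by rewrite /cheb_nat /cheb2 /=; case: cheb_pair. Qed.

Lemma cheb2S n : cheb2 n.+1 = 'X * cheb2 n + cheb_nat n.
Proof. by rewrite /cheb_nat /cheb2 /=; case: cheb_pair. Qed.

Lemma cheb_nat_rec n :
  2%:R * 'X * cheb_nat n.+1 = cheb_nat n.+2 + cheb_nat n.
Proof. by rewrite !(cheb_natS, cheb2S); ring. Qed.

(** The second identity is the derivative of [sin (n t)] seen through
[x = cos t]; the two are proved together because each step of one uses the
other. *)
Lemma deriv_cheb_pair n :
  (cheb_nat n)^`() = n%:R * cheb2 n /\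
  (1 - 'X ^+ 2) * (cheb2 n)^`() = 'X * cheb2 n - n%:R * cheb_nat n.
Proof.
elim: n => [|n [IHt IHu]].
  by split; rewrite /cheb_nat /cheb2 /= !poly.derivE; ring.
split.
  rewrite cheb_natS !poly.derivE IHt -[(1 - 'X ^+ 2) * _]opprK -mulrN.
  have -> : (1 - 'X ^+ 2) * - (cheb2 n)^`() =
            n%:R * cheb_nat n - 'X * cheb2 n by rewrite mulrN IHu; ring.
  by rewrite cheb2S -natr1; ring.
rewrite cheb_natS cheb2S !poly.derivE IHt mulrDr mulrDr mul1r.
rewrite [_ * ('X * _)]mulrCA IHu -natr1; ring.
Qed.

(** The index runs over all integers so that shifts act without boundary terms. *)
Definition cheb (i : int) : {poly F} := cheb_nat `|i|%N.

Lemma chebN i : cheb (- i) = cheb i.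
Proof. by rewrite /cheb abszN. Qed.

End Chebyshev.

(** * Products of shifts acting on Chebyshev sequences *)

Section Shifts.
Context {F : fieldType}.
Implicit Types (a : F) (s : seq F) (d : int).

(** The operator [1 - a E^d], where [E] is the shift of the index by one. *)
Definition shift_factor (V : lmodType F) d a (f : int -> V) : int -> V :=
  fun i => f i - a *: f (i + d).

Fixpoint shift_prod (V : lmodType F) d s (f : int -> V) : int -> V :=
  if s is a :: s' then shift_prod d s' (shift_factor d a f) else f.

Lemma shift_prod_linear (V W : lmodType F) (L : V -> W) d s (f : int -> V) i :
  (forall a u v, L (a *: u + v) = a *: L u + L v) ->
  L (shift_prod d s f i) = shift_prod d s (L \o f) i.
Proof.
move=> Llin; elim: s f => [//|a s IH] f /=; rewrite IH; congr (shift_prod _ _ _ _).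
by apply/funext => j; rewrite /shift_factor /= addrC -scaleNr Llin scaleNr addrC.
Qed.

(** All the operators [1 - a E^d] are polynomials in the shift, so they commute. *)
Lemma shift_prod_factor (V : lmodType F) d e s a (f : int -> V) :
  shift_prod d s (shift_factor e a f) = shift_factor e a (shift_prod d s f).
Proof.
elim: s f => [//|b s IH] f /=; rewrite -IH; congr shift_prod.
apply/funext => j; rewrite /shift_factor !scalerBr !scalerA !opprB -!addrA.
congr (_ + _); rewrite [b * a]mulrC [(e + d)%R]addrC.
by rewrite [LHS]addrC [RHS]addrC addrAC.
Qed.

Lemma eq_shift_prod (V : lmodType F) s (f g : int -> V) (N : nat) :
  (forall n, (N <= n)%N -> f n = g n) ->
  forall n, (N + size s <= n)%N -> shift_prod (-1) s f n = shift_prod (-1) s g n.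
Proof.
elim: s f g N => [|a s IH] f g N fg n /=; first by rewrite addn0; apply: fg.
rewrite addnS -addSn; apply: IH => -[//|k] lek; rewrite /shift_factor.
have -> : k.+1%:Z + -1 = k by rewrite -addn1 PoszD addrK.
by rewrite !fg // (leq_trans _ lek).
Qed.

(** The three-term recurrence on all of the integers. It is stable under the
shift operators, so what holds for Chebyshev sequences extends to their
images. *)
Definition cheb_recurrent (f : int -> {poly F}) :=
  forall i, 2%:R * 'X * f i = f (i + 1) + f (i - 1).

Lemma recurrent_cheb : cheb_recurrent cheb.
Proof.
case=> [[|n]|n].
- by rewrite /cheb /= /cheb_nat /=; ring.
- have -> : n.+1%:Z + 1 = n.+2 by rewrite -PoszD addn1.
  have -> : n.+1%:Z - 1 = n by rewrite -addn1 PoszD addrK.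
  by rewrite /cheb /= cheb_nat_rec.
- have -> : Negz n + 1 = - n%:Z by rewrite NegzE -addn1 PoszD opprD addrNK.
  have -> : Negz n - 1 = - n.+2%:Z.
    by rewrite NegzE -opprD -PoszD addn1.
  by rewrite NegzE !chebN /cheb /= cheb_nat_rec addrC.
Qed.

Lemma recurrent_factor d a f : cheb_recurrent f -> cheb_recurrent (shift_factor d a f).
Proof.
move=> wf i; rewrite /shift_factor mulrBr wf -scalerAr wf scalerDr.
by rewrite [i + d + 1]addrAC [i + d - 1]addrAC opprD addrACA.
Qed.

Lemma recurrent_shift_prod d s f :
  cheb_recurrent f -> cheb_recurrent (shift_prod d s f).
Proof. by elim: s f => //= a s IH f wf; apply/IH/recurrent_factor. Qed.

(** The product formula [2 cos (n t) cos (i t) = cos ((i + n) t) + cos ((i - n) t)]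
needs only the recurrence in the second factor. *)
Lemma mul_cheb_nat f n i : cheb_recurrent f ->
  2%:R * cheb_nat n * f i = f (i + n%:Z) + f (i - n%:Z).
Proof.
move=> wf; suff: 2%:R * cheb_nat n * f i = f (i + n%:Z) + f (i - n%:Z) /\
  2%:R * cheb_nat n.+1 * f i = f (i + n.+1%:Z) + f (i - n.+1%:Z) by case.
elim: n => [|n [IH0 IH1]].
  split; rewrite /cheb_nat /= ?addr0 ?mulr0 ?subr0 !mulr1 ?wf //; ring.
split=> //; apply: (addIr (2%:R * cheb_nat n * f i)).
rewrite -mulrDl -mulrDr -cheb_nat_rec IH0.
have -> : 2%:R * (2%:R * 'X * cheb_nat n.+1) * f i =
  2%:R * 'X * (2%:R * cheb_nat n.+1 * f i) by ring.
rewrite IH1 mulrDr !wf.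
have -> : i + n.+1%:Z + 1 = i + n.+2%:Z by rewrite -addrA -PoszD addn1.
have -> : i + n.+1%:Z - 1 = i + n%:Z by rewrite -addrA -addn1 PoszD addrK.
have -> : i - n.+1%:Z + 1 = i - n%:Z by rewrite -addn1 PoszD opprD addrA addrNK.
have -> : i - n.+1%:Z - 1 = i - n.+2%:Z by rewrite -addrA -opprD -PoszD addn1.
by ring.
Qed.

Definition joukowski a : F := (a + a^-1) / 2%:R.

(** One factor is [(1 - a E) (1 - a E^-1) f = (1 + a^2) f - a (E + E^-1) f]; the
recurrence turns [E + E^-1] into multiplication by [2 'X], and
[1 + a^2 = 2a (a + a^-1) / 2]. *)
Lemma mul_prod_shift_prod s f : (2%:R : F) != 0 -> all (predC1 0) s ->
  cheb_recurrent f ->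
  forall i, (\prod_(a <- s) (- (2%:R * a) *: ('X - (joukowski a)%:P))) * f i =
            shift_prod 1 s (shift_prod (-1) s f) i.
Proof.
move=> two0; elim: s f => [|a s IH] f /=; first by move=> _ _ i; rewrite big_nil mul1r.
move=> /andP[a0 s0] wf i; rewrite big_cons mulrAC mulrC.
have -> : - (2%:R * a) *: ('X - (joukowski a)%:P) * f i =
          shift_factor 1 a (shift_factor (-1) a f) i.
  have hJ : 2%:R * a%:P * (joukowski a)%:P = a%:P ^+ 2 + 1.
    rewrite -polyC_natr -!polyCM -polyC_exp -polyC1 -polyCD.
    by congr (_%:P); rewrite /joukowski; field; rewrite two0.
  rewrite /shift_factor addrK -!mul_polyC polyCN polyCM polyC_natr.
  have -> : - (2%:R * a%:P) * ('X - (joukowski a)%:P) * f i =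
     - a%:P * (2%:R * 'X * f i) + 2%:R * a%:P * (joukowski a)%:P * f i by ring.
  by rewrite wf hJ; ring.
rewrite (IH (shift_factor 1 a (shift_factor (-1) a f))) //;
  last by do 2 apply: recurrent_factor.
by rewrite [shift_prod (-1) s (shift_factor 1 _ _)]shift_prod_factor.
Qed.

End Shifts.

(** * Orthogonal polynomials of a bounded definite functional *)

Section Orthogonality.
Context {R : realType}.
Local Notation C := R[i].

Lemma geometric_small (q K e : R) : 0 <= q < 1 -> 0 < e ->
  exists k : nat, K * q ^+ k < e.
Proof.
move=> /andP[q0 q1] e0.
have : (fun k => K * q ^+ k) @ \oo --> (K * 0 : R).
  by apply: cvgMr; apply: cvg_expr; rewrite ger0_norm.
rewrite mulr0 => /cvgrPdist_lt /(_ _ e0) [N _ /(_ N (leqnn N))] /=.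
by rewrite sub0r normrN => /(le_lt_trans (ler_norm _)); exists N.
Qed.

Lemma shift_prod_bounded d (s : seq C) (f : int -> C^o) K :
  (forall i, cmod (f i) <= K) ->
  exists K', forall i, cmod (shift_prod d s f i) <= K'.
Proof.
elim: s f K => [|a s IH] f K fK /=; first by exists K.
apply: (IH _ (K + cmod a * K)) => i; rewrite /shift_factor.
apply: le_trans (cmodB _ _) _; apply: lerD => //.
by rewrite cmodM ler_wpM2l ?cmod_ge0.
Qed.

(** If [(1 - a E) u = 0] then [u_n = a^k u_(n+k)], which tends to 0 with [k] for
bounded [u]. The factors are peeled off one at a time. *)
Lemma bounded_shift_prod_eq0 (s : seq C) (u : int -> C^o) K :
  all (fun a => cmod a < 1) s -> (forall i, cmod (u i) <= K) ->
  (forall n : nat, (0 < n)%N -> shift_prod 1 s u n = 0) ->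
  forall n : nat, (0 < n)%N -> u n = 0.
Proof.
elim: s u K => [//|a s IH] u K /= /andP[a1 s1] uK us.
have vK i : cmod (shift_factor 1 a u i) <= K + cmod a * K.
  rewrite /shift_factor; apply: le_trans (cmodB _ _) _; apply: lerD => //.
  by rewrite cmodM ler_wpM2l ?cmod_ge0.
have v0 := IH _ _ s1 vK us.
have ue k : forall n : nat, (0 < n)%N -> u n = a ^+ k * u (n + k)%N.
  elim: k => [|k IHk] n n0; first by rewrite expr0 mul1r addn0.
  rewrite IHk // exprSr -mulrA; congr (_ * _).
  have /eqP := v0 (n + k)%N (ltn_addr _ n0).
  by rewrite /shift_factor subr_eq0 -PoszD addn1 addnS => /eqP.
move=> n n0; apply/eqP; rewrite -cmod_eq0 eq_le cmod_ge0 andbT leNgt.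
apply/negP => un.
have a01 : 0 <= cmod a < 1 by rewrite cmod_ge0.
have [k] := @geometric_small (cmod a) K (cmod (u n)) a01 un.
rewrite ltNge => /negP; apply; rewrite (ue k n n0) cmodM cmodX mulrC.
by rewrite ler_wpM2r // exprn_ge0 // cmod_ge0.
Qed.

Lemma size_shift_prod (F : fieldType) (s : seq F) (f : int -> {poly F}) (N : nat) :
  (forall n : nat, (N <= n)%N -> size (f n) = n.+1) ->
  forall n : nat, (N + size s <= n)%N -> size (shift_prod (-1) s f n) = n.+1.
Proof.
elim: s f N => [|a s IH] f N fN n /=; first by rewrite addn0; apply: fN.
rewrite addnS -addSn; apply: IH => -[//|k] lek; rewrite /shift_factor.
have -> : k.+1%:Z + -1 = k by rewrite -addn1 PoszD addrK.
have sk : size (f k.+1) = k.+2 by rewrite fN // (leq_trans _ lek).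
rewrite size_polyDl sk // ltnS size_polyN.
by rewrite (leq_trans (size_scale_leq _ _)) // fN.
Qed.

Lemma size_cheb (F : fieldType) n :
  (2%:R : F) != 0 -> size (cheb_nat n : {poly F}) = n.+1.
Proof.
move=> two0.
suff: size (cheb_nat n : {poly F}) = n.+1 /\
      size (cheb_nat n.+1 : {poly F}) = n.+2 by case.
elim: n => [|n [IH0 IH1]].
  rewrite /cheb_nat /= size_poly1; split=> //.
  by rewrite mulr1 mulr0 subr0 size_polyX.
split=> //.
have -> : cheb_nat n.+2 = 2%:R *: (cheb_nat n.+1 * 'X) - cheb_nat n :> {poly F}.
  by rewrite -mul_polyC polyC_natr; apply/eqP; rewrite eq_sym subr_eq
    -cheb_nat_rec; apply/eqP; ring.
have nz : cheb_nat n.+1 != 0 :> {poly F} by rewrite -size_poly_eq0 IH1.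
by rewrite size_polyDl size_scale // size_mulX // IH1 // size_polyN IH0.
Qed.

(** Polynomials with one term in each degree span, so a linear functional is
determined by its values on them. *)
Lemma graded_span_eq0 (F : fieldType) (T : nat -> {poly F})
    (L : {poly F} -> F) n :
  (forall j, size (T j) = j.+1) ->
  (forall a p q, L (a *: p + q) = a * L p + L q) ->
  (forall j, (j < n)%N -> L (T j) = 0) ->
  forall P : {poly F}, (size P <= n)%N -> L P = 0.
Proof.
move=> sT lL; elim: n => [|n IH] LT P sP.
  move: sP; rewrite leqn0 size_poly_eq0 => /eqP ->.
  by have := lL (-1) 0 0; rewrite scaler0 addr0 mulN1r addNr.
pose c := P`_n / lead_coef (T n).
have -> : P = c *: T n + (P - c *: T n) by rewrite addrC subrK.
rewrite lL LT // mulr0 add0r; apply: IH => [j jn|].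
  by apply: LT; rewrite ltnS ltnW.
apply/leq_sizeP => j; rewrite leq_eqVlt => /predU1P[<-|nj].
  rewrite coefB coefZ /c lead_coefE sT /= divfK ?subrr //.
  have := lead_coef_eq0 (T n).
  by rewrite lead_coefE sT /= => ->; rewrite -size_poly_eq0 sT.
rewrite coefB coefZ !nth_default ?mulr0 ?subrr ?sT //.
exact: leq_trans sP nj.
Qed.

(** The sequence [u_i] of values of [L] at [shift_prod (-1) s cheb i] is bounded
and the hypothesis on [L] says that [shift_prod 1 s u] vanishes at positive
indices, hence so does [u]. The product formula turns this into orthogonality
of [shift_prod (-1) s cheb n] to lower degrees. A multiple of it agrees with [P]
up to lower degree, and definiteness makes the difference vanish. *)
Lemma orthogonal_poly_proportional (L : {poly C} -> C) (s : seq C) (K : R) n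
    (P : {poly C}) :
  (forall a p q, L (a *: p + q) = a * L p + L q) ->
  (forall p, L (p * map_poly conjc p) = 0 -> p = 0) ->
  (forall i, cmod (L (cheb i)) <= K) ->
  all (predC1 0) s -> all (fun a => cmod a < 1) s ->
  (forall j, (0 < j)%N ->
     L ((\prod_(a <- s) ('X - (joukowski a)%:P)) * cheb_nat j) = 0) ->
  (size s < n)%N -> size P = n.+1 ->
  (forall S : {poly C}, (size S <= n)%N -> L (P * S) = 0) ->
  exists2 c, c != 0 & P = c *: shift_prod (-1) s cheb n.
Proof.
move=> lL dL LK s0 s1 Ls sn sP PL; set U := shift_prod (-1) s cheb n.
have two0 : (2%:R : C) != 0 by rewrite pnatr_eq0.
have sU : size U = n.+1.
  apply: (@size_shift_prod _ s cheb 1%N) => //.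
  by move=> k _; rewrite /cheb /= size_cheb.
pose u := L \o shift_prod (-1) s cheb.
have L0 : L 0 = 0.
  by have := lL (-1) 0 0; rewrite scaler0 addr0 mulN1r addNr.
have LZ a p : L (a *: p) = a * L p by have := lL a p 0; rewrite L0 !addr0.
have uE i : u i = shift_prod (-1) s ((L : _ -> C^o) \o cheb) i.
  by rewrite /u /= -(@shift_prod_linear _ _ C^o).
have u0 (k : nat) : (0 < k)%N -> u k = 0.
  have [K' uK'] := shift_prod_bounded (-1) s LK.
  apply: (@bounded_shift_prod_eq0 s u K' s1) => [i|j j0]; first by rewrite uE.
  rewrite /u -(@shift_prod_linear _ _ C^o) //.
  rewrite -mul_prod_shift_prod //; last exact: recurrent_cheb.
  by rewrite scaler_prod -scalerAl LZ Ls // mulr0.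
have UL (S : {poly C}) : (size S <= n)%N -> L (U * S) = 0.
  apply: (@graded_span_eq0 _ cheb_nat (fun S => L (U * S))) => [j|a p q|j jn].
  - by rewrite size_cheb.
  - by rewrite mulrDr -scalerAr lL.
  - apply: (mulfI two0); rewrite mulr0 -LZ scaler_nat -mulr_natl.
    rewrite mulrA mulrAC [_ * cheb_nat j * U]mul_cheb_nat; last first.
      by apply: recurrent_shift_prod; exact: recurrent_cheb.
    rewrite -PoszD subzn ?(ltnW jn) // -[X in X + _]scale1r lL mul1r.
    have := u0 (n + j)%N; have := u0 (n - j)%N; rewrite /u /= => -> //.
      by move=> ->; rewrite ?addr0 // ltn_addr // (leq_ltn_trans _ jn).
    by rewrite subn_gt0.
pose c := lead_coef P / lead_coef U.
have lU : lead_coef U != 0 by rewrite lead_coef_eq0 -size_poly_eq0 sU.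
exists c.
  by rewrite mulf_neq0 ?invr_eq0 // lead_coef_eq0 -size_poly_eq0 sP.
apply/eqP; rewrite -subr_eq0; apply/eqP; set D := P - _.
have sD : (size D <= n)%N.
  apply/leq_sizeP => j; rewrite leq_eqVlt => /predU1P[<-|nj].
    rewrite coefB coefZ /c !lead_coefE sU sP /= divfK ?subrr //.
    by rewrite lead_coefE sU in lU.
  by rewrite coefB coefZ !nth_default ?mulr0 ?subrr ?sP ?sU.
apply: dL; rewrite {1}/D addrC -scaleNr mulrDl -scalerAl lL.
by rewrite PL ?UL ?mulr0 ?add0r // size_map_poly.
Qed.

End Orthogonality.

(** * Primitives of the Chebyshev polynomials *)

Section Primitive.
Context {F : numFieldType}.

(** The classical primitive of [T_i], with the convention [0^-1 = 0] covering
[i = 1]. *)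
Definition cheb_prim (i : int) : {poly F} :=
  2%:R^-1 *: ((i + 1)%:~R^-1 *: cheb (i + 1) - (i - 1)%:~R^-1 *: cheb (i - 1)).

Lemma cheb_primS n : cheb_prim n.+1 =
  2%:R^-1 *: (n.+2%:R^-1 *: cheb_nat n.+2 - n%:R^-1 *: cheb_nat n).
Proof.
rewrite /cheb_prim; have -> : n.+1%:Z + 1 = n.+2%:Z by rewrite -PoszD addn1.
by have -> : n.+1%:Z - 1 = n%:Z by rewrite -addn1 PoszD addrK.
Qed.

Lemma deriv_cheb_prim n : (0 < n)%N -> (cheb_prim n)^`() = cheb_nat n.
Proof.
case: n => // n _; rewrite cheb_primS !poly.derivE !(deriv_cheb_pair _).1.
have -> : n.+2%:R^-1 *: (n.+2%:R * cheb2 n.+2) = cheb2 n.+2 :> {poly F}.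
  by rewrite -polyC_natr mul_polyC scalerA mulVf ?scale1r // pnatr_eq0.
have -> : n%:R^-1 *: (n%:R * cheb2 n) = cheb2 n :> {poly F}.
  case: n => [|n]; first by rewrite mul0r scaler0.
  by rewrite -polyC_natr mul_polyC scalerA mulVf ?scale1r // pnatr_eq0.
have -> : cheb2 n.+2 - cheb2 n = 2%:R *: cheb_nat n.+1 :> {poly F}.
  by rewrite scaler_nat -mulr_natl !(cheb2S, cheb_natS); ring.
by rewrite scalerA mulVf ?scale1r // pnatr_eq0.
Qed.

Lemma horner_cheb (w : F) n : w != 0 ->
  (cheb_nat n).[joukowski w] = (w ^+ n + w ^- n) / 2%:R.
Proof.
move=> w0.
suff: (cheb_nat n).[joukowski w] = (w ^+ n + w ^- n) / 2%:R /\
  (cheb_nat n.+1).[joukowski w] = (w ^+ n.+1 + w ^- n.+1) / 2%:R by case.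
elim: n => [|n [IH0 IH1]].
  split; rewrite /cheb_nat /= ?expr0 ?expr1 ?invr1 !hornerE ; first by field.
  by rewrite subr0.
split=> //; have := congr1 (horner^~ (joukowski w)) (@cheb_nat_rec F n).
rewrite !hornerE IH0 IH1 => /eqP; rewrite -subr_eq => /eqP <-.
rewrite /joukowski /= !exprS; field.
by rewrite w0 expf_neq0.
Qed.

End Primitive.

(** * Growth of the primitives off the segment *)

Section Growth.
Context {R : realType}.
Local Notation C := R[i].
Implicit Types (s : seq C) (w a : C).

Lemma shift_prod_upper s (f : int -> C^o) (N : nat) (K x : R) : 1 <= x ->
  all (fun a => cmod a <= 1) s ->
  (forall n : nat, (N <= n)%N -> cmod (f n) <= K * x ^+ n.+1) ->
  forall n : nat, (N + size s <= n)%N ->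
    cmod (shift_prod (-1) s f n) <= 2%:R ^+ size s * K * x ^+ n.+1.
Proof.
move=> x1; elim: s f N K => [|a s IH] f N K /=.
  by move=> _ fN n; rewrite addn0 expr0 mul1r; apply: fN.
move=> /andP[a1 s1] fN n; rewrite addnS -addSn exprSr -!mulrA mulrA.
rewrite -mulrA [2%:R * (K * _)]mulrA mulrA; apply: IH => // -[//|k] lek.
rewrite /shift_factor; have -> : k.+1%:Z + -1 = k by rewrite -addn1 PoszD addrK.
apply: le_trans (cmodB _ _) _; rewrite -mulrA mulr_natl mulr2n; apply: lerD.
  by apply: fN; rewrite (leq_trans _ lek).
have fk : cmod (f k) <= K * x ^+ k.+1 by apply: fN.
rewrite cmodM (le_trans (ler_piMl (cmod_ge0 _) a1)) // (le_trans fk) //.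
have x0 : 0 < x by rewrite (lt_le_trans _ x1).
rewrite ler_wpM2l // ?ler_weXn2l //.
by rewrite -(pmulr_lge0 _ (exprn_gt0 k.+1 x0)) (le_trans (cmod_ge0 _) fk).
Qed.

(** [f w n ~ g w * w ^+ n / n] as [n] grows, uniformly for [|w| >= r]. The error is
measured relative to [|w|], which makes it uniform on this unbounded set. *)
Definition asymptotic (r : R) (f : C -> int -> C^o) (g : C -> C) :=
  forall e : R, 0 < e -> exists N : nat, forall n : nat, (N <= n)%N ->
  forall w, r <= cmod w -> cmod (n%:R * f w n / w ^+ n - g w) <= e * cmod w.

(** Passing from [n] to [n - 1] divides the main term [g w * w ^+ n / n] by [w], up
to the factor [n / (n - 1)] which tends to 1. *)
Lemma asymptotic_factor r f g a (B : R) : 1 <= r -> cmod a <= 1 ->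
  (forall w, r <= cmod w -> cmod (g w) <= B * cmod w) ->
  asymptotic r f g ->
  asymptotic r (fun w => shift_factor (-1) a (f w)) (fun w => g w * (1 - a / w)).
Proof.
move=> r1 a1 gB fg e e0.
have e4 : 0 < e / 4%:R by rewrite divr_gt0 // ltr0n.
have [N fN] := fg _ e4.
have [M BM] : exists M : nat, (`|B| + e) / (e / 4%:R) <= M%:R.
  exists (Num.truncn ((`|B| + e) / (e / 4%:R))).+1.
  by rewrite ltW // truncnS_gt.
(* [M] makes [(|B| + e) |w| / k], the cost of replacing [(k + 1) / k] by 1,
   at most [e / 4] relative to [|w|]. *)
exists (maxn N M).+2 => -[//|k]; rewrite ltnS gtn_max => /andP[Nk Mk] w rw.
have w1 : 1 <= cmod w by rewrite (le_trans r1).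
have w0 : w != 0 by rewrite -cmod_gt0 (lt_le_trans _ w1).
have k0 : (0 < k)%N by rewrite (leq_ltn_trans _ Nk).
rewrite /shift_factor; have -> : k.+1%:Z + -1 = k by rewrite -addn1 PoszD addrK.
set h := k%:R * f w k / w ^+ k; set h' := k.+1%:R * f w k.+1 / w ^+ k.+1.
have kn0 : (k%:R : C) != 0 by rewrite pnatr_eq0 -lt0n.
have -> : k.+1%:R * (f w k.+1 - a *: f w k) / w ^+ k.+1 - g w * (1 - a / w) =
  (h' - g w) - (a / w) * ((h - g w) + ((h - g w) + g w) / k%:R).
  rewrite /h /h' exprS -natr1 /GRing.scale /=; field.
  by rewrite kn0 w0 expf_neq0.
have E1 : cmod (h' - g w) <= e / 4%:R * cmod w.
  by apply: fN => //; rewrite (leq_trans (ltnW Nk)).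
have E2 : cmod (h - g w) <= e / 4%:R * cmod w by apply: fN => //; exact: ltnW.
have kM : M%:R <= k%:R :> R by rewrite ler_nat ltnW.
have kR : 0 < k%:R :> R by rewrite ltr0n.
have E3 : cmod (((h - g w) + g w) / k%:R) <= e / 4%:R * cmod w.
  rewrite cmodM cmodV cmod_nat ler_pdivrMr //.
  apply: le_trans (cmodD _ _) _.
  apply: (@le_trans _ _ ((`|B| + e) * cmod w)).
    rewrite mulrDl addrC; apply: lerD.
      apply: le_trans (gB _ rw) _; rewrite ler_wpM2r ?cmod_ge0 //.
      exact: ler_norm.
    apply: le_trans E2 _; rewrite ler_wpM2r ?cmod_ge0 //; lra.
  rewrite mulrAC ler_wpM2r ?cmod_ge0 // mulrC -ler_pdivrMr //.
  exact: le_trans BM kM.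
apply: le_trans (cmodB _ _) _.
have aw : cmod (a / w) <= 1.
  by rewrite cmodM cmodV ler_pdivrMr ?mul1r ?(le_trans a1) // (lt_le_trans _ w1).
have : cmod (a / w * (h - g w + (h - g w + g w) / k%:R)) <=
    e / 4%:R * cmod w + e / 4%:R * cmod w.
  rewrite cmodM (le_trans (ler_piMl (cmod_ge0 _) aw)) //.
  by rewrite (le_trans (cmodD _ _)) // lerD.
have := cmod_ge0 w; nra.
Qed.

Lemma asymptotic_shift_prod r s f g (B : R) : 1 <= r ->
  all (fun a => cmod a <= 1) s ->
  (forall w, r <= cmod w -> cmod (g w) <= B * cmod w) ->
  asymptotic r f g ->
  asymptotic r (fun w => shift_prod (-1) s (f w))
    (fun w => g w * \prod_(a <- s) (1 - a / w)).
Proof.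
move=> r1; elim: s f g B => [|a s IH] f g B /=.
  move=> _ _; congr asymptotic.
  by apply/funext => w; rewrite big_nil mulr1.
move=> /andP[a1 s1] gB fg.
have -> : (fun w => g w * \prod_(b <- a :: s) (1 - b / w)) =
    (fun w => (g w * (1 - a / w)) * \prod_(b <- s) (1 - b / w)).
  by apply/funext => w; rewrite big_cons mulrA.
apply: (IH _ _ (B * 2%:R)) => // [w rw|]; last exact: asymptotic_factor gB fg.
rewrite cmodM mulrAC; apply: ler_pM; rewrite ?cmod_ge0 ?gB //.
apply: le_trans (cmodB _ _) _; rewrite cmod1 mulr2n lerD //.
have w1 : 1 <= cmod w by rewrite (le_trans r1).
by rewrite cmodM cmodV ler_pdivrMr ?mul1r ?(le_trans a1) // (lt_le_trans _ w1).
Qed.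

Lemma asymptotic_cheb_prim r : 1 < r ->
  asymptotic r (fun w i => (cheb_prim i).[joukowski w])
    (fun w => (w - w^-1) / 4%:R).
Proof.
move=> r1 e e0; have r0 : 0 < r by rewrite (lt_trans _ r1).
have q01 : 0 <= r^-1 < 1 by rewrite invr_ge0 ltW //= invf_lt1.
have e3 : 0 < e / 3%:R by rewrite divr_gt0 // ltr0n.
have [K HK] := @geometric_small R r^-1 1 (e / 3%:R) q01 e3.
have [M HM] : exists M : nat, 3%:R / e <= M%:R.
  by exists (Num.truncn (3%:R / e)).+1; rewrite ltW // truncnS_gt.
exists (maxn K M).+2 => -[//|k]; rewrite ltnS gtn_max => /andP[Kk Mk] w rw.
have w1 : 1 < cmod w by rewrite (lt_le_trans r1).
have w0 : w != 0 by rewrite -cmod_gt0 (lt_trans _ w1).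
have k0 : (0 < k)%N by rewrite (leq_ltn_trans _ Kk).
have kn0 : (k%:R : C) != 0 by rewrite pnatr_eq0 -lt0n.
have kR : 1 <= k%:R :> R by rewrite ler1n.
rewrite cheb_primS !hornerE !horner_cheb //=.
set T := (X in cmod X).
have -> : T =
  4%:R^-1 * (k.+1%:R / k.+2%:R * w ^- (k + k + 3) - w / k.+2%:R
     - (1 + k%:R^-1) * w ^- (k + k + 1) - w^-1 / k%:R).
  rewrite /T !exprD !exprS expr0 -!natr1; field.
  rewrite w0 kn0 expf_neq0 //= natr1 natr1 pnatr_eq0 //.
have ke : k%:R^-1 <= e / 3%:R.
  rewrite -[e / 3%:R]invrK lef_pV2 ?posrE ?invr_gt0 ?divr_gt0 ?ltr0n //.
  by rewrite invf_div (le_trans HM) // ler_nat ltnW.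
have wX n : (K <= n)%N -> cmod (w ^- n) <= e / 3%:R.
  move=> Kn; rewrite cmodV cmodX -exprVn; apply: le_trans (ltW HK).
  rewrite mul1r; apply: (@le_trans _ _ (r^-1 ^+ n)).
    rewrite lerXn2r ?nnegrE ?invr_ge0 ?cmod_ge0 ?(ltW r0) //.
    by rewrite lef_pV2 ?posrE // (lt_trans _ w1).
  by rewrite ler_wiXn2l ?invr_ge0 ?(ltW r0) // invf_le1 // ltW.
have Kk2 n : (K <= k + k + n)%N by rewrite -addnA ltnW // (leq_trans Kk) // leq_addr.
rewrite cmodM cmodV cmod_nat.
have EA : cmod (k.+1%:R / k.+2%:R * w ^- (k + k + 3)) <= e / 3%:R.
  rewrite cmodM (le_trans _ (wX _ (Kk2 3))) // ler_piMl ?cmod_ge0 //.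
  by rewrite cmodM cmodV !cmod_nat ler_pdivrMr ?ltr0n // mul1r ler_nat.
have EB : cmod (w / k.+2%:R) <= e / 3%:R * cmod w.
  rewrite cmodM cmodV cmod_nat mulrC ler_wpM2r ?cmod_ge0 // (le_trans _ ke) //.
  by rewrite lef_pV2 ?posrE ?ltr0n // ler_nat ltnW.
have ED : cmod ((1 + k%:R^-1) * w ^- (k + k + 1)) <= 2%:R * (e / 3%:R).
  rewrite cmodM; apply: ler_pM; rewrite ?cmod_ge0 ?wX //.
  apply: le_trans (cmodD _ _) _; rewrite cmod1 cmodV cmod_nat mulr2n lerD2l.
  by rewrite invf_le1 // ltr0n.
have EE : cmod (w^-1 / k%:R) <= e / 3%:R.
  rewrite cmodM !cmodV cmod_nat (le_trans _ ke) // ler_piMl ?invr_ge0 //.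
  by rewrite invf_le1 ?ltW // (lt_trans _ w1).
set A := (X in X - _ - _ - _); set B := (X in A - X - _ - _) in EB *.
set D := (X in A - B - X - _) in ED *; set E := w^-1 / _ in EE *.
have := cmodB (A - B - D) E; have := cmodB (A - B) D; have := cmodB A B.
move: EA; rewrite -/A; nra.
Qed.
End Growth.

(** * Separation of level sets *)

Section Separation.
Context {R : realType}.
Local Notation C := R[i].
Implicit Types (s : seq C) (w a z : C).

(** With [p = sqrt q] and [h = p^-1 - 1], Bernoulli's inequality bounds [n p^n] by
[h^-1], and [n q^n = (n p^n) p^n]. *)
Lemma linear_geometric_small (q K e : R) : 0 < q < 1 -> 0 <= K -> 0 < e ->
  exists N : nat, forall n : nat, (N <= n)%N -> n%:R * K * q ^+ n < e.
Proof.
move=> /andP[q0 q1] K0 e0; pose p := Num.sqrt q.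
have p0 : 0 < p by rewrite sqrtr_gt0.
have p2 : p ^+ 2 = q by rewrite sqr_sqrtr // ltW.
have p1 : p < 1 by rewrite -(@ltr_pXn2r _ 2) // ?nnegrE ?(ltW p0) // expr1n p2.
pose h := p^-1 - 1.
have h0 : 0 < h by rewrite subr_gt0 invf_gt1.
have np n : n%:R * p ^+ n <= h^-1.
  rewrite -ler_pdivlMr ?exprn_gt0 // -exprVn -ler_pdivrMl ?invr_gt0 // invrK.
  have -> : p^-1 = 1 + h by rewrite /h addrC subrK.
  elim: n => [|n IH]; first by rewrite mulr0 expr0.
  rewrite exprS [(1 + h) * _]mulrDl mul1r -natr1 mulrDr mulr1 lerD //.
  rewrite ler_peMr ?(ltW h0) //.
  by rewrite exprn_ege1 // lerDl ltW.
have p01 : 0 <= p < 1 by rewrite ltW.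
have [N HN] := @geometric_small R p (K / h) e p01 e0.
exists N => n Nn; apply: le_lt_trans HN.
have -> : n%:R * K * q ^+ n = n%:R * p ^+ n * (K * p ^+ n).
  by rewrite -p2 -exprM mul2n -addnn exprD; ring.
apply: (@le_trans _ _ (h^-1 * (K * p ^+ n))).
  by rewrite ler_wpM2r // mulr_ge0 // exprn_ge0 // ltW.
rewrite mulrA [h^-1 * K]mulrC ler_wpM2l ?mulr_ge0 ?invr_ge0 ?(ltW h0) //.
by rewrite ler_wiXn2l // ltW.
Qed.

(** Each of the factors [1 - a / w] and [1 - w^-1 / w] has modulus at least
[1 - r^-1]. *)
Lemma leading_lower r s w : 1 < r -> all (fun a => cmod a <= 1) s ->
  r <= cmod w ->
  (1 - r^-1) ^+ (size s).+1 / 4%:R * cmod w <=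
  cmod ((w - w^-1) / 4%:R * \prod_(a <- s) (1 - a / w)).
Proof.
move=> r1 s1 rw; have r0 : 0 < r by rewrite (lt_trans _ r1).
have w0 : 0 < cmod w by rewrite (lt_le_trans r0).
have w1 : 1 <= cmod w by rewrite (le_trans (ltW r1)).
have Vw : (cmod w)^-1 <= r^-1 by rewrite lef_pV2.
have q0 : 0 <= 1 - r^-1 by rewrite subr_ge0 invf_le1 // ltW.
have prodB : (1 - r^-1) ^+ size s <= cmod (\prod_(a <- s) (1 - a / w)).
  elim: s s1 => [|a s IH] /=; first by rewrite big_nil expr0 cmod1.
  move=> /andP[a1 s1]; rewrite big_cons exprS cmodM ler_pM ?exprn_ge0 ?IH //.
  apply: le_trans (cmod_triangle _ _); rewrite cmod1 cmodN lerD2l lerN2.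
  rewrite cmodM cmodV (le_trans _ Vw) // ler_piMl ?invr_ge0 ?(ltW w0) //.
rewrite !cmodM cmodV cmod_nat exprSr.
have wB : (1 - r^-1) * cmod w <= cmod (w - w^-1).
  apply: le_trans (cmod_triangle _ _); rewrite cmodN cmodV mulrBl mul1r lerD2l.
  rewrite lerN2 (le_trans Vw) // ler_peMr // invr_ge0 ltW //.
have -> : (1 - r^-1) ^+ size s * (1 - r^-1) / 4%:R * cmod w =
  ((1 - r^-1) * cmod w / 4%:R) * (1 - r^-1) ^+ size s by ring.
apply: ler_pM => //; rewrite ?exprn_ge0 //.
  by rewrite !mulr_ge0 // ltW.
by rewrite ler_wpM2r.
Qed.

Lemma horner_shift_prod_prim s z n :
  (shift_prod (-1) s cheb_prim n).[z] =
  shift_prod (-1) s (fun i => (cheb_prim i).[z] : C^o) n.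
Proof.
apply: (@shift_prod_linear _ _ C^o (fun p => p.[z])) => a u v.
by rewrite hornerD hornerZ.
Qed.

Lemma prim_upper s w n : all (fun a => cmod a <= 1) s -> 1 <= cmod w ->
  (1 + size s <= n)%N ->
  cmod (shift_prod (-1) s cheb_prim n).[joukowski w] <=
    2%:R ^+ size s * 2%:R * cmod w ^+ n.+1.
Proof.
move=> s1 w1 sn; rewrite horner_shift_prod_prim.
apply: (@shift_prod_upper _ _ _ 1%N) => // -[//|k] _.
have w0 : w != 0 by rewrite -cmod_gt0 (lt_le_trans _ w1).
have T m : (m <= k.+2)%N -> cmod (cheb_nat m).[joukowski w] <= cmod w ^+ k.+2.
  move=> mk; rewrite horner_cheb // cmodM cmodV cmod_nat ler_pdivrMr //.
  apply: le_trans (cmodD _ _) _; rewrite mulr_natr mulr2n cmodV !cmodX lerD //.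
    by rewrite ler_weXn2l.
  by rewrite -exprVn (@le_trans _ _ 1) ?exprn_ege1 // exprn_ile1 ?invr_ge0
    ?cmod_ge0 // invf_le1 // cmod_gt0.
suff: cmod (cheb_prim k.+1).[joukowski w] <= 2%:R * cmod w ^+ k.+2 by [].
move: (cmod w ^+ k.+2) T => W T.
rewrite cheb_primS !hornerE /= cmodM cmodV cmod_nat.
have V2 (x : C) m : (cmod (m%:R^-1 * x)) <= cmod x.
  rewrite cmodM cmodV cmod_nat ler_piMl ?cmod_ge0 //.
  by case: m => [|m]; rewrite ?invr0 // invf_le1 ?ltr0n // ler1n.
have := cmodB (k.+2%:R^-1 * (cheb_nat k.+2).[joukowski w])
              (k%:R^-1 * (cheb_nat k).[joukowski w]).
have := V2 (cheb_nat k.+2).[joukowski w] k.+2.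
have := V2 (cheb_nat k).[joukowski w] k.
have := T k.+2 (leqnn _); have := T k (leqW (leqnSn k)).
have := cmod_ge0 (k.+2%:R^-1 * (cheb_nat k.+2).[joukowski w] -
   k%:R^-1 * (cheb_nat k).[joukowski w]).
lra.
Qed.

Lemma prim_lower s r : 1 < r -> all (fun a => cmod a <= 1) s ->
  exists2 c : R, 0 < c & exists N : nat, forall n : nat, (N <= n)%N ->
    forall w, r <= cmod w ->
    c * cmod w ^+ n.+1 <= n%:R * cmod (shift_prod (-1) s cheb_prim n).[joukowski w].
Proof.
move=> r1 s1; pose c := (1 - r^-1) ^+ (size s).+1 / 4%:R.
have r0 : 0 < r by rewrite (lt_trans _ r1).
have c0 : 0 < c by rewrite divr_gt0 // ?exprn_gt0 // subr_gt0 invf_lt1.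
have c2 : 0 < c / 2%:R by rewrite divr_gt0.
exists (c / 2%:R) => //.
have gB w : r <= cmod w -> cmod ((w - w^-1) / 4%:R) <= 1 * cmod w.
  move=> rw; have w1 : 1 <= cmod w by rewrite (le_trans (ltW r1)).
  have w0 : 0 < cmod w by rewrite (lt_le_trans _ w1).
  rewrite cmodM cmodV cmod_nat mul1r ler_pdivrMr //.
  apply: le_trans (cmodB _ _) _; rewrite cmodV.
  have : (cmod w)^-1 <= 1 by rewrite invf_le1.
  lra.
have [N HN] :=
  asymptotic_shift_prod (ltW r1) s1 gB (asymptotic_cheb_prim r1) c2.
exists (maxn N 1) => n; rewrite geq_max => /andP[Nn n1] w rw.
have := HN n Nn w rw; rewrite -horner_shift_prod_prim.
have := leading_lower r1 s1 rw.
set g := _ * \prod_(a <- s) _; set f := (shift_prod _ _ _ _).[_] => gL.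
have w0 : w != 0 by rewrite -cmod_gt0 (lt_le_trans r0).
have fE : n%:R * cmod f = cmod (n%:R * f / w ^+ n) * cmod w ^+ n.
  by rewrite !cmodM cmodV cmod_nat cmodX divfK // expf_neq0 // cmod_eq0.
rewrite fE exprS mulrA => fg.
rewrite ler_wpM2r ?exprn_ge0 ?cmod_ge0 //.
have := cmod_triangle g (n%:R * f / w ^+ n - g).
rewrite [g + _]addrC subrK; move: fg gL; rewrite -/c; lra.
Qed.

(** The lower bound [c |w2|^(n+1) / n] exceeds the upper bound [K |w1|^(n+1)] once
[n (r1 / r2)^(n+1)] is small. *)
Lemma prim_separation s (r1 r2 : R) : all (fun a => cmod a <= 1) s ->
  1 <= r1 -> r1 < r2 ->
  exists N : nat, forall n : nat, (N <= n)%N ->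
  forall w1 w2, 1 <= cmod w1 <= r1 -> r2 <= cmod w2 ->
    (shift_prod (-1) s cheb_prim n).[joukowski w1] <>
    (shift_prod (-1) s cheb_prim n).[joukowski w2].
Proof.
move=> s1 r11 r12; have r21 : 1 < r2 by rewrite (le_lt_trans r11).
have r10 : 0 < r1 by rewrite (lt_le_trans _ r11).
have r20 : 0 < r2 by rewrite (lt_trans r10).
have [c c0 [N HN]] := prim_lower r21 s1.
pose K : R := 2%:R ^+ size s * 2%:R.
have q01 : 0 < r1 / r2 < 1 by rewrite divr_gt0 //= ltr_pdivrMr // mul1r.
have K0 : 0 <= K by rewrite mulr_ge0 // exprn_ge0.
have [M HM] := linear_geometric_small q01 K0 c0.
exists (maxn (maxn N M) (1 + size s)) => n; rewrite !geq_max.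
move=> /andP[/andP[Nn Mn] sn] w1 w2 /andP[w11 w1r] rw2 eqF.
have := HN n Nn w2 rw2; rewrite -eqF; apply/negP; rewrite -ltNge.
have up := prim_upper s1 w11 sn.
apply: (@le_lt_trans _ _ (n%:R * (K * cmod w1 ^+ n.+1))).
  by rewrite ler_wpM2l.
apply: (@le_lt_trans _ _ (n%:R * (K * r1 ^+ n.+1))).
  by rewrite !ler_wpM2l // lerXn2r ?nnegrE ?cmod_ge0 // ltW.
apply: (@lt_le_trans _ _ (c * r2 ^+ n.+1)); last first.
  by rewrite ler_wpM2l ?(ltW c0) // lerXn2r ?nnegrE ?cmod_ge0 // ltW.
rewrite -ltr_pdivrMr ?exprn_gt0 //.
have -> : n%:R * (K * r1 ^+ n.+1) / r2 ^+ n.+1 = n%:R * K * (r1 / r2) ^+ n.+1.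
  by rewrite expr_div_n !mulrA.
apply: le_lt_trans (HM n Mn); rewrite ler_wpM2l ?mulr_ge0 //.
by have /andP[q0 q1] := q01; rewrite ler_wiXn2l // ltW.
Qed.

End Separation.

(** * The map phi and the ellipse *)

Section Ellipse.
Context {R : realType}.
Local Notation C := R[i].
Implicit Types (w z zeta : C).

Lemma joukowskiV w : joukowski w^-1 = joukowski w.
Proof. by rewrite /joukowski invrK addrC. Qed.

(** Both determinations [z + w] and [z - w] are inverse to each other and are sent
to [z] by [joukowski]. *)
Lemma phi_root z : phi z != 0 /\ joukowski (phi z) = z.
Proof.
rewrite /phi; set w := sqrtC _.
have E : (z + w) * (z - w) = 1.
  by rewrite mulrC -subr_sqr sqrtCK opprB addrC subrK.
have n1 : z + w != 0.
  by apply: contraTneq isT => zw; move: E; rewrite zw mul0r => /eqP;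
     rewrite eq_sym oner_eq0.
have V : (z + w)^-1 = z - w by rewrite -[LHS]mulr1 -E mulKf.
have J : joukowski (z + w) = z.
  by rewrite /joukowski V addrACA subrr addr0; field.
by case: ifP => _ //; rewrite -V invr_eq0 joukowskiV.
Qed.

Lemma phi_neq0 z : phi z != 0. Proof. by have [] := phi_root z. Qed.

Lemma joukowski_phi z : joukowski (phi z) = z.
Proof. by have [] := phi_root z. Qed.

Lemma cmod_phi_ge1 z : 1 <= cmod (phi z).
Proof.
rewrite /phi; set w := sqrtC _; case: ifP => [/ltW //|/negbT].
rewrite -leNgt => zw.
have E : (z + w) * (z - w) = 1.
  by rewrite mulrC -subr_sqr sqrtCK opprB addrC subrK.
have : cmod (z + w) * cmod (z - w) = 1 by rewrite -cmodM E cmod1.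
move=> <-; rewrite ler_piMl ?cmod_ge0 //.
Qed.

(** [joukowski w - 1] and [joukowski w + 1] are [(w - 1)^2 / 2w] and
[(w + 1)^2 / 2w]; this is the statement that the image of a circle centred at 0
is an ellipse with foci -1 and 1. *)
Lemma focal_sum_joukowski w : w != 0 ->
  cmod (joukowski w - 1) + cmod (joukowski w + 1) = cmod w + (cmod w)^-1.
Proof.
move=> w0; have cw0 : cmod w != 0 by rewrite cmod_eq0.
have -> : joukowski w - 1 = (w - 1) ^+ 2 / (2%:R * w).
  by rewrite /joukowski; field; rewrite w0.
have -> : joukowski w + 1 = (w + 1) ^+ 2 / (2%:R * w).
  by rewrite /joukowski; field; rewrite w0.
rewrite 2![cmod (_ / _)]cmodM !cmodX !cmodV [cmod (_ * w)]cmodM cmod_nat -mulrDl.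
have -> : cmod (w - 1) ^+ 2 + cmod (w + 1) ^+ 2 = 2%:R * (cmod w ^+ 2 + 1).
  rewrite !cmod_sqr; case: w w0 cw0 => a b _ _ /=; ring.
by field; rewrite cw0.
Qed.

Lemma joukowski_sum_lt (x y : R) : 1 <= x -> x < y -> x + x^-1 < y + y^-1.
Proof.
move=> x1 xy; have y1 : 1 < y by rewrite (le_lt_trans x1).
have x0 : 0 < x by rewrite (lt_le_trans _ x1).
have y0 : 0 < y by rewrite (lt_trans _ y1).
rewrite -subr_gt0; have -> : y + y^-1 - (x + x^-1) = (y - x) * (1 - (x * y)^-1).
  by field; rewrite !gt_eqF.
rewrite mulr_gt0 ?subr_gt0 // invf_lt1 ?mulr_gt0 //.
by rewrite (lt_le_trans y1) // ler_peMl // ltW.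
Qed.

(** The sum of the distances to the foci is continuous and, by [focal_sum_phi], an
increasing function of [cmod (phi z)]. It replaces continuity of [cmod \o phi],
which is not apparent through the choice of branches. *)
Definition focal_sum z : R := cmod (z - 1) + cmod (z + 1).

Lemma focal_sum_phi z : focal_sum z = cmod (phi z) + (cmod (phi z))^-1.
Proof. by rewrite -focal_sum_joukowski ?phi_neq0 // joukowski_phi. Qed.

Lemma cmod_phi_lt z (r : R) : 1 <= r -> focal_sum z < r + r^-1 -> cmod (phi z) < r.
Proof.
move=> r1; rewrite focal_sum_phi ltNge => h; rewrite ltNge; apply: contra h.
rewrite le_eqVlt => /predU1P[<-//|]; move/(joukowski_sum_lt r1); exact: ltW.
Qed.

Lemma cmod_phi_gt z (r : R) : r + r^-1 < focal_sum z -> r < cmod (phi z).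
Proof.
rewrite focal_sum_phi ltNge => h; rewrite ltNge; apply: contra h.
rewrite le_eqVlt => /predU1P[<-//|].
by move/(joukowski_sum_lt (cmod_phi_ge1 z)); exact: ltW.
Qed.

Lemma focal_sum_lipschitz z w : `|focal_sum z - focal_sum w| <= 2%:R * cmod (z - w).
Proof.
have key u v : cmod u - cmod v <= cmod (u - v).
  by have := cmodD (u - v) v; rewrite subrK lerBlDr.
have key2 u v d : u - v = d -> `|cmod u - cmod v| <= cmod d.
  move=> <-; rewrite ler_norml key lerNl opprB andbT.
  by rewrite -(cmodN (u - v)) opprB key.
have -> : focal_sum z - focal_sum w =
  (cmod (z - 1) - cmod (w - 1)) + (cmod (z + 1) - cmod (w + 1)).
  by rewrite /focal_sum; ring.
apply: le_trans (ler_normD _ _) _; rewrite mulr_natl mulr2n lerD //.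
  by apply: key2; ring.
by apply: key2; ring.
Qed.

(** On the unit circle [w^-1] is the conjugate of [w], so [joukowski w] is the real
part of [w]. *)
Lemma joukowski_unit_segment w : cmod w = 1 -> unit_segment (joukowski w).
Proof.
move=> w1; exists (complex.Re w).
  have := cmod_sqr w; rewrite w1 expr1n /= in_itv /= -ler_norml => h.
  rewrite -(@ler_pXn2r _ 2) ?nnegrE // real_normK ?num_real // expr1n h.
  by rewrite lerDl sqr_ge0.
have V : w^-1 = w^*%C.
  have w0 : w != 0 by rewrite -cmod_eq0 w1 oner_eq0.
  apply: (mulfI w0); rewrite mulfV //; have := add_Re2_Im2 w.
  rewrite -cmodE w1 => /= h; rewrite -[LHS](expr1n _ 2) -h.
  by case: (w) => a b /=; simpc; rewrite !expr2; congr (_ +i* _); ring.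
rewrite /joukowski V; case: (w) => a b /=.
apply/eqP; rewrite eq_complex /=; apply/andP; split; apply/eqP; last first.
  by simpc; ring.
by simpc; field.
Qed.

Lemma cmod_phi_gt1 zeta : ~ unit_segment zeta -> 1 < cmod (phi zeta).
Proof.
move=> zU; rewrite lt_neqAle cmod_phi_ge1 andbT; apply/eqP => E.
by apply: zU; rewrite -(joukowski_phi zeta); exact: joukowski_unit_segment.
Qed.

Lemma polar_angle (c s : R) : c ^+ 2 + s ^+ 2 = 1 ->
  exists2 t : R, t \in `[0, 2 * pi[ & cos t = c /\ sin t = s.
Proof.
move=> cs.
have c1 : -1 <= c <= 1.
  rewrite -ler_norml -(@ler_pXn2r _ 2) ?nnegrE // real_normK ?num_real //.
  by rewrite expr1n -cs lerDl sqr_ge0.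
have cA : cos (acos c) = c by rewrite acosK.
have sA : sin (acos c) = `|s|.
  by rewrite sin_acos // -cs addrAC subrr add0r sqrtr_sqr.
have pi0 := pi_gt0 R.
have A0 := acos_ge0 c1; have A1 := acos_lepi c1.
have [s0|s0] := leP 0 s.
  (* The arccosine gives the angles in the upper half circle, its reflection the
     others. *)
  exists (acos c); first by rewrite in_itv /=; apply/andP; split=> //; lra.
  by rewrite cA sA ger0_norm.
exists (2 * pi - acos c).
  rewrite in_itv /=; apply/andP; split; first by lra.
  suff a0 : acos c != 0.
    have : 0 < acos c by rewrite lt_def a0 A0.
    lra.
  apply: contraTneq s0 => a0; move: sA; rewrite a0 sin0 => /esym/eqP.
  by rewrite normr_eq0 => /eqP ->; rewrite ltxx.
have -> : 2 * pi - acos c = - acos c + pi *+ 2 by rewrite mulr_natl addrC.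
by rewrite cosD2pi sinD2pi cosN sinN cA sA ltr0_norm ?opprK.
Qed.

Lemma cexp_conj x y : cexp (x +i* y : C) * cexp (- (x +i* y)) = 1.
Proof.
rewrite /cexp /= cosN sinN expRN mulrACA -rmorphM /= divff ?mul1r ?gt_eqF ?expR_gt0 //.
simpc.
have := cos2Dsin2 y => h.
by apply/eqP; rewrite eq_complex /= -{1}h; apply/andP; split; apply/eqP; ring.
Qed.

Lemma ellipse_phi zeta z : cmod (phi z) = cmod (phi zeta) -> ellipse zeta z.
Proof.
move=> E; set r := cmod (phi z).
have r0 : 0 < r by rewrite cmod_gt0 phi_neq0.
have rr : expR (Defs.eta zeta) = r by rewrite /Defs.eta -E lnK.
case F : (phi z) => [a b].
have ab : a ^+ 2 + b ^+ 2 = r ^+ 2 by rewrite /r cmod_sqr F.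
have [t t_in [ct st]] : exists2 t : R, t \in `[0, 2 * pi[ &
    cos t = a / r /\ sin t = b / r.
  by apply: polar_angle; rewrite !expr_div_n -mulrDl ab divff // expf_neq0 // gt_eqF.
exists t => //.
have X : cexp (Defs.eta zeta +i* t) = phi z.
  rewrite /cexp /= rr ct st F; simpc.
  by congr (_ +i* _); rewrite mulrC divfK // gt_eqF.
rewrite -[RHS]joukowski_phi /ccosh /joukowski; congr ((_ + _) / _) => //.
by rewrite -X -[LHS](mulKf (_ : phi z != 0)) ?phi_neq0 // -{2}X cexp_conj mulr1 X.
Qed.

End Ellipse.

(** * Zeros on a level set of the primitive *)

Section Accumulation.
Context {R : realType}.
Local Notation C := R[i].

Lemma polar_opE (zeta : C) (f : {poly C}) :
  polar_op zeta f = (('X - zeta%:P) * f)^`().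
Proof. by rewrite /polar_op derivM derivXsubC mul1r. Qed.

Lemma eq_horner_deriv (F : numFieldType) (p q : {poly F}) x y :
  p^`() = q^`() -> p.[x] - q.[x] = p.[y] - q.[y].
Proof.
move=> pq; have d0 : (p - q)^`() = 0 by rewrite derivB pq subrr.
have /size1_polyC E : (size (p - q)%R <= 1)%N.
  apply/leq_sizeP => -[//|j] _; have := congr1 (fun u : {poly F} => u`_j) d0.
  by rewrite /= coef_deriv coef0 => /eqP; rewrite mulrn_eq0 => /eqP.
by rewrite -!hornerN -!hornerD E !hornerC.
Qed.

Lemma deriv_shift_prod_prim (F : numFieldType) (s : seq F) n : (size s < n)%N ->
  (shift_prod (-1) s cheb_prim n)^`() = shift_prod (-1) s cheb n.
Proof.
move=> sn; rewrite (shift_prod_linear (L := (@deriv F))); last first.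
  by move=> a u v; rewrite derivD derivZ.
by apply: (@eq_shift_prod _ _ _ _ _ 1%N) => // k k0; exact: deriv_cheb_prim.
Qed.

(** [('X - zeta) Q] and [c F] have the same derivative, so they differ by a constant,
and the first one vanishes both at [zeta] and at the zeros of [Q]. *)
Lemma root_level (zeta : C) (s : seq C) n (Q : {poly C}) c w :
  (size s < n)%N -> c != 0 ->
  polar_op zeta Q = c *: shift_prod (-1) s cheb n -> root Q w ->
  (shift_prod (-1) s cheb_prim n).[w] = (shift_prod (-1) s cheb_prim n).[zeta].
Proof.
move=> sn c0 QE /rootP Qw; apply: (mulfI c0).
have /(eq_horner_deriv w zeta) : (('X - zeta%:P) * Q)^`() =
    (c *: shift_prod (-1) s cheb_prim n)^`().
  by rewrite -polar_opE QE derivZ deriv_shift_prod_prim.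
by rewrite !hornerM !hornerXsubC Qw subrr mulr0 mul0r !sub0r !hornerZ => /oppr_inj.
Qed.

(** If [|phi z|] were not [|phi zeta|], a number [r] strictly between them would
separate [|phi (w k)|] from [|phi zeta|] for large [k], by continuity of
[focal_sum], whereas [w k] and [zeta] are on the same level set. *)
Lemma accumulation_in_ellipse (zeta : C) (s : seq C) (Q : nat -> {poly C}) :
  ~ unit_segment zeta ->
  all (fun a => cmod a <= 1) s ->
  (forall n, (size s < n)%N ->
     exists2 c, c != 0 & polar_op zeta (Q n) = c *: shift_prod (-1) s cheb n) ->
  zero_accumulation Q `<=` ellipse zeta.
Proof.
move=> zU s1 QE z [n [w [n_oo Qw wz]]]; apply: ellipse_phi.
have z1 := cmod_phi_gt1 zU.
have evN (N : nat) : \forall k \near \oo, (N <= n k)%N.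
  exact: n_oo (nbhs_infty_ge N).
have focal_sum_cvg (e : R) : 0 < e ->
    \forall k \near \oo, `|focal_sum (w k) - focal_sum z| < e.
  move=> e0.
  have e2 : 0 < (e / 2%:R)%:C by rewrite (ltcR 0) divr_gt0.
  move/cvgrPdist_lt : wz => /(_ _ e2); apply: filterS => k.
  rewrite distrC -cmodE ltcR => h; apply: le_lt_trans (focal_sum_lipschitz _ _) _.
  by rewrite mulrC -ltr_pdivlMr.
have level k : (size s < n k)%N ->
    (shift_prod (-1) s cheb_prim (n k)).[joukowski (phi (w k))] =
    (shift_prod (-1) s cheb_prim (n k)).[joukowski (phi zeta)].
  move=> sn; have [c c0 Ec] := QE _ sn.
  by rewrite !joukowski_phi; exact: root_level Ec (Qw k).
have [lt|gt|//] := ltgtP (cmod (phi z)) (cmod (phi zeta)).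
- pose r := (cmod (phi z) + cmod (phi zeta)) / 2%:R.
  have zr : cmod (phi z) < r by rewrite /r; lra.
  have rz : r < cmod (phi zeta) by rewrite /r; lra.
  have r1 : 1 <= r by rewrite (le_trans (cmod_phi_ge1 z)) // ltW.
  have [N HN] := prim_separation s1 r1 rz.
  have fr : 0 < r + r^-1 - focal_sum z.
    by rewrite subr_gt0 focal_sum_phi joukowski_sum_lt // cmod_phi_ge1.
  have [k [[Nk sk] fk]] := @filter_ex _ _ eventually_filter _
    (filterI (filterI (evN N) (evN (size s).+1)) (focal_sum_cvg _ fr)).
  case: (HN (n k) Nk (phi (w k)) (phi zeta)); rewrite ?lexx ?level //.
  rewrite cmod_phi_ge1 ltW // cmod_phi_lt //.
  move: fk; rewrite ltr_norml => /andP[_]; lra.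
- pose r := (cmod (phi z) + cmod (phi zeta)) / 2%:R.
  have zr : r < cmod (phi z) by rewrite /r; lra.
  have rz : cmod (phi zeta) < r by rewrite /r; lra.
  have r1 : 1 <= r by rewrite ltW // (lt_trans z1).
  have [N HN] := prim_separation s1 (ltW z1) rz.
  have fr : 0 < focal_sum z - (r + r^-1).
    by rewrite subr_gt0 focal_sum_phi joukowski_sum_lt.
  have [k [[Nk sk] fk]] := @filter_ex _ _ eventually_filter _
    (filterI (filterI (evN N) (evN (size s).+1)) (focal_sum_cvg _ fr)).
  case: (HN (n k) Nk (phi zeta) (phi (w k))); rewrite ?level // ?lexx ?andbT ?ltW //.
  apply: cmod_phi_gt; move: fk; rewrite ltr_norml => /andP[]; lra.
Qed.

End Accumulation.

(** * Integration against a density *)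

Section Density.
Context d (T : measurableType d) (R : realType).
Variables (mu nu : {measure set T -> \bar R}) (g : T -> R).
Hypothesis g0 : forall x, 0 <= g x.
Hypothesis mg : measurable_fun setT g.
Hypothesis nuE : forall A, measurable A ->
  nu A = (\int[mu]_(x in A) (g x)%:E)%E.
Local Open Scope ereal_scope.
Import HBNNSimple.

Let integral_density_nnsfun (h : {nnsfun T >-> R}) :
  \int[nu]_x (h x)%:E = \int[mu]_x ((h x)%:E * (g x)%:E).
Proof.
have mh y : measurable (h @^-1` [set y]) by [].
rewrite integralT_nnsfun sintegralE.
transitivity (\sum_(y \in range h)
    \int[mu]_x ((y * \1_(h @^-1` [set y]) x * g x)%R%:E)).
  apply: eq_fsbigr => y; rewrite inE => -[t _ hty].
  have y0 : (0 <= y)%R by rewrite -hty.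
  rewrite nuE // [X in _ * X]integral_mkcond /= -ge0_integralZl //.
  - apply: eq_integral => x _; rewrite patchE indicE.
    case: ifP => _; first by rewrite -EFinM mulr1.
    by rewrite mule0 mulr0 mul0r.
  - by apply/(measurable_restrictT _ _).1 => //; apply: measurable_funTS;
      exact/measurable_EFinP.
  - by move=> x _; rewrite patchE; case: ifP => // _; rewrite lee_fin.
rewrite -ge0_integral_fsum //.
- apply: eq_integral => x _; rewrite fsumEFin // -EFinM; congr EFin.
  rewrite [in RHS](fimfunE h x) mulr_fsuml //.
- move=> y; apply/measurable_EFinP; apply: measurable_funM => //.
  by apply: measurable_funM => //; exact: measurable_indic.
- move=> y x _; rewrite lee_fin mulr_ge0 //.
  by have := nnfun_muleindic_ge0 h y x; rewrite -EFinM lee_fin.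
Qed.

Let ge0_integral_densityT (f : T -> \bar R) : measurable_fun setT f ->
  (forall x, 0 <= f x) -> \int[nu]_x f x = \int[mu]_x (f x * (g x)%:E).
Proof.
move=> mf f0; pose h := nnsfun_approx measurableT mf.
have hf x : (h n x)%:E @[n --> \oo] --> f x by exact: cvg_nnsfun_approx.
have hfg x : (h n x)%:E * (g x)%:E @[n --> \oo] --> f x * (g x)%:E.
  by apply: cvgeZr => //; exact: hf.
have nd x : {homo (fun n => h n x) : a b / (a <= b)%N >-> (a <= b)%R}.
  by move=> a b ab; exact/lefP/nd_nnsfun_approx.
have Lnu : \int[nu]_x (h n x)%:E @[n --> \oo] --> \int[nu]_x f x.
  have -> : \int[nu]_x f x = \int[nu]_x limn (fun n => (h n x)%:E).
    by apply: eq_integral => x _; exact/esym/cvg_lim.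
  apply: cvg_monotone_convergence => //.
  - by move=> n; exact/measurable_EFinP.
  - by move=> n x _; rewrite lee_fin.
  - by move=> x _ a b ab; rewrite lee_fin nd.
have Lmu : \int[mu]_x ((h n x)%:E * (g x)%:E) @[n --> \oo] -->
    \int[mu]_x (f x * (g x)%:E).
  have -> : \int[mu]_x (f x * (g x)%:E) =
      \int[mu]_x limn (fun n => (h n x)%:E * (g x)%:E).
    by apply: eq_integral => x _; exact/esym/cvg_lim.
  apply: cvg_monotone_convergence => //.
  - by move=> n; apply/measurable_EFinP; exact: measurable_funM.
  - by move=> n x _; rewrite mule_ge0 ?lee_fin.
  - by move=> x _ a b ab; rewrite lee_wpmul2r ?lee_fin ?nd.
apply: cvg_unique Lnu _; first exact: ereal_hausdorff.
rewrite (_ : (fun n => _) = (fun n => \int[mu]_x ((h n x)%:E * (g x)%:E))) //.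
by apply/funext => n; exact: integral_density_nnsfun.
Qed.

(** True for indicators by hypothesis, hence for nonnegative simple functions, hence
for all nonnegative measurable functions by monotone convergence. *)
Lemma ge0_integral_density (D : set T) (f : T -> \bar R) : measurable D ->
  measurable_fun D f -> (forall x, D x -> 0 <= f x) ->
  \int[nu]_(x in D) f x = \int[mu]_(x in D) (f x * (g x)%:E).
Proof.
move=> mD mf f0; rewrite integral_mkcond ge0_integral_densityT.
- rewrite [RHS]integral_mkcond; apply: eq_integral => x _.
  by rewrite !patchE; case: ifP => //; rewrite mul0e.
- exact/(measurable_restrictT _ _).1.
- by move=> x; rewrite patchE; case: ifP => // /set_mem /f0.
Qed.

End Density.

(** * Measures with a reciprocal polynomial density *)

Section BernsteinSzego.
Context {R : realType}.
Variables (mu : {finite_measure set (measurableTypeR R) -> \bar R}).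
Variable (p : {poly R}).
Local Notation leb := (@lebesgue_measure R).
Local Notation I := (`[(-1)%R, 1%R]%classic : set (measurableTypeR R)).
Local Notation dens := (@chebyshev_density R).
Hypothesis p_neq0 : p != 0.
Hypothesis p_ge0 : forall x : R, x \in `[-1, 1] -> 0 <= p.[x].
Hypothesis muE : forall A : set (measurableTypeR R), measurable A ->
  mu A = (\int[chebyshev_measure]_(x in A `&` I) (p.[x]^-1)%:E)%E.

(** The density of [mu] with respect to the Lebesgue measure. *)
Definition weight : R -> R := (fun x => p.[x]^-1 * dens x) \_ I.

Lemma weightE x : x \in `[-1, 1] -> weight x = p.[x]^-1 * dens x.
Proof. by move=> xI; rewrite /weight patchE mem_set. Qed.

Lemma weight_ge0 x : 0 <= weight x.
Proof.
rewrite /weight patchE; case: ifP => // /set_mem /= xI.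
by rewrite mulr_ge0 ?invr_ge0 ?p_ge0 ?chebyshev_density_ge0.
Qed.

Lemma measurable_horner (f : {poly R}) (D : set (measurableTypeR R)) :
  measurable_fun D (fun x : measurableTypeR R => f.[x]).
Proof.
apply: measurable_funTS; apply: continuous_measurable_fun => x.
apply: differentiable_continuous; apply/derivable1_diffP.
exact: derivable_horner.
Qed.

Let mI : measurable I.
Proof. exact: measurable_itv. Qed.

Let mpV : measurable_fun I (fun x : measurableTypeR R => p.[x]^-1).
Proof.
apply: (@eq_measurable_fun _ _ _ _ I (fun x : R => p.[x] `^ (-1))).
  by move=> x /set_mem /= xI; rewrite powR_inv1 // p_ge0.
apply: measurable_funTS.
apply: (@measurableT_comp _ _ _ _ _ _ (fun x : R => x `^ (-1))).
  exact: measurable_powR.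
exact: measurable_horner.
Qed.

Lemma measurable_weight : measurable_fun (setT : set (measurableTypeR R)) weight.
Proof.
apply/(measurable_restrictT _ _).1 => //; apply: measurable_funM => //.
by apply: measurable_funTS; exact: measurable_chebyshev_density.
Qed.

Lemma mu_lebesgueE (A : set (measurableTypeR R)) : measurable A ->
  mu A = (\int[leb]_(x in A) (weight x)%:E)%E.
Proof.
move=> mA; rewrite muE //.
rewrite (@ge0_integral_density _ _ _ leb chebyshev_measure (dens \_ I)) //.
- rewrite integral_mkcondr; apply: eq_integral => x _ /=.
  by rewrite /weight !patchE; case: (x \in _).
- by move=> x; rewrite patchE; case: ifP => // _; exact: chebyshev_density_ge0.
- apply/(measurable_restrictT _ _).1 => //; apply: measurable_funTS.
  exact: measurable_chebyshev_density.
- move=> B mB; rewrite [LHS]integral_mkcondr; apply: eq_integral => x _.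
  by rewrite !patchE; case: ifP.
- exact: measurableI.
- by apply/measurable_EFinP; apply: measurable_funS mpV => // x [].
- by move=> x [_ xI]; rewrite lee_fin invr_ge0 p_ge0.
Qed.

Lemma integral_mu (f : R -> R) : measurable_fun I f ->
  (forall x, x \in `[-1, 1] -> 0 <= f x) ->
  (\int[mu]_(x in I) (f x)%:E = \int[leb]_(x in I) (f x * weight x)%:E)%E.
Proof.
move=> mf f0; rewrite (@ge0_integral_density _ _ _ leb mu weight) //.
- exact: weight_ge0.
- exact: measurable_weight.
- exact: mu_lebesgueE.
- exact/measurable_EFinP.
Qed.

Lemma horner_bound (f : {poly R}) :
  exists2 M : R, 0 < M & forall x, x \in `[-1, 1] -> `|f.[x]| <= M.
Proof.
exists (1 + \sum_(i < size f) `|f`_i|).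
  by rewrite ltr_wpDr // sumr_ge0.
move=> x; rewrite in_itv /= -ler_norml => x1.
rewrite horner_coef (le_trans (ler_norm_sum _ _ _)) //.
apply: ler_wpDl => //; apply: ler_sum => i _.
by rewrite normrM ler_piMr // normrX exprn_ile1.
Qed.

Lemma countable_roots (f : {poly R}) : f != 0 -> countable [set x | root f x].
Proof.
move=> f0; apply: finite_set_countable.
apply: (@sub_finite_set _ _ [set` rootsR f]); last exact: finite_seq.
by move=> x /= fx; rewrite -(roots_on_rootsR f0) in_itv /= fx.
Qed.

Lemma lebesgue_roots (f : {poly R}) : f != 0 -> leb [set x | root f x] = 0%E.
Proof. by move=> f0; apply: countable_lebesgue_measure0; exact: countable_roots. Qed.

Lemma measurable_roots (f : {poly R}) : f != 0 ->
  measurable ([set x | root f x] : set (measurableTypeR R)).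
Proof.
move=> f0; apply: countable_measurable => [t|]; first exact: measurable_set1.
exact: countable_roots.
Qed.

Lemma chebyshev_density_ge1 x : -1 < x < 1 -> 1 <= dens x.
Proof.
move=> /andP[x1 x2]; have s0 : 0 < 1 - x ^+ 2 by nra.
rewrite /chebyshev_density invf_ge1 ?sqrtr_gt0 //.
by rewrite -[X in _ <= X]sqrtr1 ler_sqrt // lerBlDr lerDl sqr_ge0.
Qed.

(** The Chebyshev density is at least 1 inside the segment, so there [mu] dominates
the Lebesgue measure divided by a bound on [p]. *)
Lemma mu_lower (A : set (measurableTypeR R)) (M : R) : measurable A ->
  A `<=` `]-1, 1[ -> 0 < M -> (forall x, A x -> p.[x] <= M) ->
  ((M^-1)%:E * leb A <= mu A)%E.
Proof.
move=> mA AI M0 pM; rewrite mu_lebesgueE // -(integral_cst leb mA (M^-1)%:E).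
apply: ae_ge0_le_integral => //.
- by move=> x _; rewrite lee_fin invr_ge0 ltW.
- by move=> x _; rewrite lee_fin weight_ge0.
- by apply/measurable_EFinP; apply: measurable_funTS; exact: measurable_weight.
- exists [set x | root p x]; split.
  + exact: measurable_roots.
  + exact: lebesgue_roots.
  move=> x /= /not_implyP[Ax]; apply: contra_notT => px; rewrite lee_fin.
  have := AI x Ax; rewrite /= in_itv /= => x1; have /andP[x2 x3] := x1.
  have xI : x \in `[-1, 1] by rewrite in_itv /= !ltW.
  have p0 : 0 < p.[x] by rewrite lt_def p_ge0 // andbT; exact: px.
  rewrite weightE // -[M^-1]mulr1; apply: ler_pM => //.
  + by rewrite invr_ge0 ltW.
  + by rewrite lef_pV2 ?posrE // pM.
  + exact: chebyshev_density_ge1.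
Qed.


(** Near a zero [x0], [p] is at most [C |x - x0|], so an interval of length [e]
ending at [x0] has measure at least [1 / C] whatever [e]. These intervals
decrease to the empty set as [e] tends to 0, contradicting continuity from
above of a finite measure. *)
Lemma density_root_free x0 : x0 \in `[-1, 1] -> ~~ root p x0.
Proof.
rewrite in_itv /= => /andP[x1 x2]; apply/negP => /factor_theorem[q pq].
have [C C0 qC] := horner_bound q.
(* The interval goes to the right of [x0] when [x0 <= 0] and to the left
   otherwise, so that it stays inside the segment. *)
pose e k : R := k.+1%:R^-1.
have e0 k : 0 < e k by rewrite invr_gt0.
have e1 k : e k <= 1 by rewrite invf_le1 // ler1n.
pose a k := if x0 <= 0 then x0 else x0 - e k.
pose b k := if x0 <= 0 then x0 + e k else x0.
have ab k : [/\ -1 <= a k, b k <= 1 & b k - a k = e k].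
  rewrite /a /b; have := e1 k; have := e0 k.
  by case: ifP => ? ? ?; split; lra.
pose B k : set (measurableTypeR R) := `]a k, b k[%classic.
have lebB k : leb (B k) = (e k)%:E.
  have [_ _ abk] := ab k.
  rewrite lebesgue_measure_itv /= lte_fin -subr_gt0 abk e0 -abk.
  by rewrite EFinB.
have Bx k x : B k x -> `|x - x0| <= e k /\ x != x0.
  rewrite /B /= in_itv /= /a /b => /andP[]; case: ifP => _ h1 h2.
    by split; [rewrite ler_norml; apply/andP; split; have := e0 k; lra |
      rewrite gt_eqF].
  by split; [rewrite ler_norml; apply/andP; split; have := e0 k; lra | rewrite lt_eqF].
have BI k : B k `<=` `]-1, 1[.
  have [h1 h2 _] := ab k; move=> x; rewrite /B /= !in_itv /= => /andP[ax xb].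
  by rewrite (le_lt_trans h1) //= (lt_le_trans xb).
have muB k : ((C^-1)%:E <= mu (B k))%E.
  have -> : (C^-1)%:E = ((C * e k)^-1%:E * leb (B k))%E.
    by rewrite lebB -EFinM invfM -mulrA mulVf ?mulr1 // gt_eqF.
  apply: mu_lower; [exact: measurable_itv | exact: BI | by rewrite mulr_gt0 |].
  move=> x Bkx; rewrite pq hornerM hornerXsubC (le_trans (ler_norm _)) //.
  rewrite normrM; apply: ler_pM => //; last by have [] := Bx k x Bkx.
  have := BI k x Bkx; rewrite /= in_itv /= => /andP[h1 h2].
  by apply: qC; rewrite in_itv /= !ltW.
have capB : \bigcap_k B k = set0.
  apply/seteqP; split => // x Bxk; have [_ xx0] := Bx 0%N x (Bxk 0%N Logic.I).
  have d0 : 0 < `|x - x0| by rewrite normr_gt0 subr_eq0.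
  pose k := Num.truncn (`|x - x0|^-1).
  have [+ _] := Bx k x (Bxk k Logic.I); rewrite leNgt => /negP; apply.
  rewrite /e -[ltRHS]invrK ltf_pV2 ?posrE ?invr_gt0 //.
  exact: truncnS_gt.
have cvB : mu \o B @ \oo --> mu (\bigcap_k B k).
  apply: nonincreasing_cvg_mu.
  - by rewrite -ge0_fin_numE // fin_num_measure //; exact: measurable_itv.
  - by move=> k; exact: measurable_itv.
  - by rewrite capB.
  - apply/nonincreasing_seqP => k; rewrite subsetEset => x.
    have ek : e k.+1 <= e k by rewrite lef_pV2 ?posrE // ler_nat.
    rewrite /B /= !in_itv /= /a /b => /andP[]; case: ifP => _ h1 h2.
      by apply/andP; split; lra.
    by apply/andP; split; lra.
have : ((C^-1)%:E <= mu (\bigcap_k B k))%E.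
  rewrite -(cvg_lim _ cvB) //; apply: lime_ge.
    by apply/cvg_ex; eexists; exact: cvB.
  by apply: nearW => k; exact: muB.
by rewrite capB measure0 lee_fin leNgt invr_gt0 C0.
Qed.

(** A nonzero [f] would be positive off a finite set, which would then carry all the
mass of [mu], while the rest of the segment has positive Lebesgue measure. *)
Lemma integral_poly_eq0 (f : {poly R}) :
  (forall x, x \in `[-1, 1] -> 0 <= f.[x]) ->
  (\int[mu]_(x in I) (f.[x])%:E)%E = 0%E -> f = 0.
Proof.
move=> f0 intf; apply/eqP; apply: contraT => fn0.
pose A : set (measurableTypeR R) := `]-1, 1[%classic `\` [set x | root f x].
have mA : measurable A.
  by apply: measurableD; [exact: measurable_itv | exact: measurable_roots].
have AI : A `<=` `]-1, 1[ by move=> x [].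
have muA : mu A = 0%E.
  have : (\int[mu]_(x in I) `|(f.[x])%:E|)%E = 0%E.
    rewrite -[RHS]intf; apply: eq_integral => x /set_mem /= xI.
    by rewrite /= ger0_norm // f0.
  move/(ae_eq_integral_abs mu mI); case/(_ _).
    by apply/measurable_EFinP; exact: measurable_horner.
  move=> N [mN N0 fN]; apply/eqP; rewrite eq_le measure_ge0 andbT -N0.
  apply: le_measure; rewrite ?inE // => x [x1 fx]; apply: fN => /= h.
  apply: fx; rewrite /root /=; move: x1; rewrite /= in_itv /= => /andP[x1 x2].
  have xI : x \in `[-1, 1] by rewrite in_itv /= !ltW.
  by have [->] : (f.[x])%:E = 0%:E := h xI.
have [M M0 pM] := horner_bound p.
have lebA : leb A = 0%E.
  have : ((M^-1)%:E * leb A <= mu A)%E.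
    apply: mu_lower => // x /AI; rewrite /= in_itv /= => /andP[x1 x2].
    by rewrite (le_trans (ler_norm _)) // pM // in_itv /= !ltW.
  rewrite muA => h; apply/eqP; rewrite eq_le measure_ge0 andbT.
  by move: h; rewrite pmule_rle0 // lte_fin invr_gt0.
pose J : set (measurableTypeR R) := `]-1, 1[%classic.
have : (leb J <= leb A + leb [set x | root f x])%E.
  apply: le_trans (measureU2 _ mA (measurable_roots fn0)).
  apply: le_measure; rewrite ?inE.
  - exact: measurable_itv.
  - by apply: measurableU => //; exact: measurable_roots.
  - by move=> x x1; have [?|?] := pselect (root f x); [right|left].
rewrite lebA lebesgue_roots // adde0 lebesgue_measure_itv /= lte_fin.
by rewrite ifT; [rewrite -EFinB lee_fin; lra | lra].
Qed.

End BernsteinSzego.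

(** * Chebyshev polynomials integrate to zero *)

Section ChebyshevIntegral.
Context {R : realType}.
Local Notation leb := (@lebesgue_measure R).
Local Notation dens := (@chebyshev_density R).
Implicit Types x t : R.

Lemma cheb_cos n t :
  (cheb_nat n).[cos t] = cos (n%:R * t) /\
  (cheb2 n).[cos t] * sin t = sin (n%:R * t).
Proof.
elim: n => [|n [IHt IHu]].
  by rewrite /cheb_nat /cheb2 /= mul0r cos0 sin0 hornerC horner0 mul0r.
have -> : n.+1%:R * t = n%:R * t + t by rewrite -natr1 mulrDl mul1r.
rewrite cheb_natS cheb2S cosD sinD -IHt -IHu !hornerE /=.
have c2 : cos t * cos t + sin t * sin t = 1 :> R by rewrite -!expr2 cos2Dsin2.
by split; [rewrite -c2; ring | ring].
Qed.

Lemma cheb_bound n x : x \in `[-1, 1] -> `|(cheb_nat n).[x]| <= 1.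
Proof.
rewrite in_itv /= => x1; rewrite -(acosK x1) (cheb_cos _ _).1.
by rewrite ler_norml cos_geN1 cos_le1.
Qed.

(** This is [- sin (n t) / n] at [x = cos t], the primitive of
[T_n(x) / sqrt(1 - x^2)]. *)
Definition cheb_density_prim n x : R :=
  - n%:R^-1 * ((cheb2 n).[x] * Num.sqrt (1 - x ^+ 2)).

Lemma is_derive_cheb_density_prim n x : (0 < n)%N -> -1 < x < 1 ->
  is_derive x 1 (cheb_density_prim n) ((cheb_nat n).[x] * dens x).
Proof.
move=> n0 /andP[x1 x2]; have s0 : 0 < 1 - x ^+ 2 by nra.
have rt0 : 0 < Num.sqrt (1 - x ^+ 2) by rewrite sqrtr_gt0.
have dU : is_derive x 1 (fun y : R => (cheb2 n).[y]) ((cheb2 n)^`()).[x].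
  apply: DeriveDef; first exact: derivable_horner.
  by rewrite -derive1E -derivE.
have d1 : is_derive x 1 (fun y : R => 1 - y ^+ 2) (- (2%:R * x)).
  by apply: is_derive_eq; rewrite /GRing.scale /=; ring.
have dS : is_derive x 1 (fun y : R => Num.sqrt (1 - y ^+ 2))
    ((2%:R * Num.sqrt (1 - x ^+ 2))^-1 * - (2%:R * x)).
  exact: (@is_derive1_comp _ (@Num.sqrt R) (fun y : R => 1 - y ^+ 2) x _ _
    (is_derive1_sqrt s0) d1).
rewrite /cheb_density_prim; apply: is_derive_eq; rewrite /GRing.scale /=.
set S := Num.sqrt _ in rt0 *.
have SS : S * S = 1 - x ^+ 2 by rewrite -expr2 sqr_sqrtr // ltW.
have hU : (1 - x ^+ 2) * ((cheb2 n)^`()).[x] =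
    x * (cheb2 n).[x] - n%:R * (cheb_nat n).[x].
  have := congr1 (horner^~ x) (@deriv_cheb_pair R n).2.
  by rewrite -polyC_natr !hornerE.
have -> : S * ((cheb2 n)^`()).[x] =
    (x * (cheb2 n).[x] - n%:R * (cheb_nat n).[x]) / S.
  by rewrite -hU -SS; field; rewrite gt_eqF.
rewrite /chebyshev_density -/S; field.
by rewrite gt_eqF //= pnatr_eq0 -lt0n.
Qed.

Lemma continuous_cheb_density_prim n : continuous (cheb_density_prim n).
Proof.
move=> x; apply: cvgM; first exact: cvg_cst.
apply: cvgM.
  by apply: differentiable_continuous; apply/derivable1_diffP; exact: derivable_horner.
apply: (@continuous_comp _ _ _ (fun y : R => 1 - y ^+ 2)).
  apply: cvgB; first exact: cvg_cst.
  exact: exprn_continuous.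
exact: sqrt_continuous.
Qed.

Lemma cheb_density_prim_end n (x : R) : x ^+ 2 = 1 -> cheb_density_prim n x = 0.
Proof. by move=> x1; rewrite /cheb_density_prim x1 subrr sqrtr0 !mulr0. Qed.

Lemma horner_density_within (f : {poly R}) a b : -1 < a -> b < 1 ->
  {within `[a, b], continuous (fun x => f.[x] * dens x)}.
Proof.
move=> a1 b1; apply: continuous_in_subspaceT => x /set_mem /=.
rewrite in_itv /= => /andP[ax xb]; have s0 : 0 < 1 - x ^+ 2 by nra.
apply: cvgM.
  by apply: differentiable_continuous; apply/derivable1_diffP; exact: derivable_horner.
apply: cvgV; first by rewrite gt_eqF // sqrtr_gt0.
apply: (@continuous_comp _ _ _ (fun y : R => 1 - y ^+ 2)).
  apply: cvgB; first exact: cvg_cst.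
  exact: exprn_continuous.
exact: sqrt_continuous.
Qed.

Lemma integral_cheb_shift n a b : (0 < n)%N -> -1 < a -> a < b -> b < 1 ->
  (\int[leb]_(x in `[a, b]) (((cheb_nat n).[x] + 1) * dens x)%:E =
   \int[leb]_(x in `[a, b]) (dens x)%:E +
     (cheb_density_prim n b - cheb_density_prim n a)%:E)%E.
Proof.
move=> n0 a1 ab b1.
have inI x : x \in `]a, b[ -> -1 < x < 1.
  by rewrite in_itv /= => /andP[ax xb]; apply/andP; split; lra.
have ctT := @horner_density_within (cheb_nat n) a b a1 b1.
have ct1 : {within `[a, b], continuous dens}.
  have -> : dens = (fun x => (1 : {poly R}).[x] * dens x) :> (R -> R).
    by apply/funext => x; rewrite hornerC mul1r.
  exact: horner_density_within.
have Tint : (\int[leb]_(x in `[a, b]) ((cheb_nat n).[x] * dens x)%:E =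
    (cheb_density_prim n b)%:E - (cheb_density_prim n a)%:E)%E.
  apply: continuous_FTC2 => //.
  - split.
    + by move=> x /inI x1; have [] := is_derive_cheb_density_prim n0 x1.
    + by apply: cvg_at_right_filter; exact: continuous_cheb_density_prim.
    + by apply: cvg_at_left_filter; exact: continuous_cheb_density_prim.
  - move=> x /inI x1; rewrite derive1E; apply: derive_val.
    exact: is_derive_cheb_density_prim.
have iab f : {within `[a, b], continuous f} -> leb.-integrable `[a, b] (EFin \o f).
  move=> cf; apply: continuous_compact_integrable => //; exact: segment_compact.
rewrite EFinB -Tint -integralD //=.
- by apply: eq_integral => x _; rewrite -EFinD mulrDl mul1r addrC.
- exact: iab.
- exact: (iab (fun x => (cheb_nat n).[x] * dens x)).
Qed.

(** The integrand [T_n(x) / sqrt(1 - x^2)] is unbounded at the ends. Adding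
[1 / sqrt(1 - x^2)] makes it nonnegative, so that the integral over the segment
is the limit of those over smaller segments, finite or not. *)
Lemma integral_cheb_density n : (0 < n)%N ->
  (\int[leb]_(x in `[(-1)%R, 1%R]) (((cheb_nat n).[x] + 1) * dens x)%:E =
   \int[leb]_(x in `[(-1)%R, 1%R]) (dens x)%:E)%E.
Proof.
move=> n0.
pose e k : R := k.+2%:R^-1.
have e0 k : 0 < e k by rewrite invr_gt0.
have e1 k : e k < 1 by rewrite invf_lt1 // ltr1n.
pose F k : set (measurableTypeR R) := `[-1 + e k, 1 - e k]%classic.
have F1 k x : F k x -> -1 < x < 1.
  by rewrite /F /= in_itv /= => /andP[h1 h2]; apply/andP; split; have := e0 k; lra.
have ndF : nondecreasing_seq F.
  apply/nondecreasing_seqP => k; rewrite subsetEset => x.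
  have : e k.+1 <= e k by rewrite lef_pV2 ?posrE // ler_nat.
  by rewrite /F /= !in_itv /= => h /andP[h1 h2]; apply/andP; split; lra.
have UF : \bigcup_k F k = `]-1, 1[%classic.
  apply/seteqP; split => x; first by move=> [k _ /F1]; rewrite /= in_itv.
  rewrite /= in_itv /= => /andP[x1 x2].
  pose d := Num.min (x + 1) (1 - x).
  have d0 : 0 < d by rewrite lt_min; apply/andP; split; lra.
  exists (Num.truncn d^-1) => //; rewrite /F /= in_itv /=.
  have : e (Num.truncn d^-1) <= d.
    rewrite -[leRHS]invrK lef_pV2 ?posrE ?invr_gt0 //.
    by rewrite ltW // (lt_trans (truncnS_gt _)) // ltr_nat.
  by rewrite le_min => /andP[h1 h2]; apply/andP; split; lra.
have mF k : measurable (F k) by exact: measurable_itv.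
have mT (D : set (measurableTypeR R)) :
    measurable_fun D (fun x : R => ((cheb_nat n).[x] + 1) * dens x).
  apply: measurable_funM; last first.
    by apply: measurable_funTS; exact: measurable_chebyshev_density.
  by apply: measurable_funD => //; exact: measurable_horner.
have mD (D : set (measurableTypeR R)) : measurable_fun D dens.
  by apply: measurable_funTS; exact: measurable_chebyshev_density.
have cT := @ge0_nondecreasing_set_cvg_integral _ _ R F
  (fun x => (((cheb_nat n).[x] + 1) * dens x)%:E) leb ndF mF.
have cD := @ge0_nondecreasing_set_cvg_integral _ _ R F
  (fun x => (dens x)%:E) leb ndF mF.
rewrite integral_itv_bndoo; last by apply/measurable_EFinP; exact: mT.
rewrite [RHS]integral_itv_bndoo; last by apply/measurable_EFinP; exact: mD.
have {}cT : (\int[leb]_(x in F k) (((cheb_nat n).[x] + 1) * dens x)%:E)%E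
    @[k --> \oo] -->
    (\int[leb]_(x in `](-1)%R, 1%R[) (((cheb_nat n).[x] + 1) * dens x)%:E)%E.
  rewrite -UF; apply: cT => [k|k x /F1 /andP[x1 x2]].
    by apply/measurable_EFinP; exact: mT.
  rewrite lee_fin mulr_ge0 ?chebyshev_density_ge0 //.
  have /(cheb_bound n) : x \in `[-1, 1] by rewrite in_itv /= !ltW.
  by rewrite ler_norml => /andP[h _]; lra.
have {}cD : (\int[leb]_(x in F k) (dens x)%:E)%E
    @[k --> \oo] --> (\int[leb]_(x in `](-1)%R, 1%R[) (dens x)%:E)%E.
  rewrite -UF; apply: cD => [k|k x _]; first by apply/measurable_EFinP; exact: mD.
  by rewrite lee_fin chebyshev_density_ge0.
have ecvg : e k @[k --> \oo] --> (0 : R).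
  have := @cvg_harmonic R; rewrite -(cvg_shiftS _ _).
  exact.
have G0 : (cheb_density_prim n (1 - e k) - cheb_density_prim n (-1 + e k))
    @[k --> \oo] --> (0 : R).
  rewrite -[X in _ --> X](subrr (0 : R)); apply: cvgB.
    rewrite -(@cheb_density_prim_end n (1 - 0)); last by rewrite subr0 expr1n.
    apply: continuous_cvg; first exact: continuous_cheb_density_prim.
    by apply: cvgB; [exact: cvg_cst|].
  rewrite -(@cheb_density_prim_end n (-1 + 0)); last by rewrite addr0 sqrrN expr1n.
  apply: continuous_cvg; first exact: continuous_cheb_density_prim.
  by apply: cvgD; [exact: cvg_cst|].
have cS : ((\int[leb]_(x in F k) (dens x)%:E) +
    (cheb_density_prim n (1 - e k) - cheb_density_prim n (-1 + e k))%:E)%E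
    @[k --> \oo] --> (\int[leb]_(x in `](-1)%R, 1%R[) (dens x)%:E + 0%:E)%E.
  apply: cvgeD => //; first by rewrite fin_num_adde_defl.
  by apply: cvg_EFin => //; exact: nearW.
rewrite adde0 in cS; apply: cvg_unique cT _; first exact: ereal_hausdorff.
apply: cvg_trans cS; apply: near_eq_cvg; apply: nearW => k; apply/esym.
have := e0 k; have := e1 k => h1 h2.
by apply: integral_cheb_shift => //; lra.
Qed.
End ChebyshevIntegral.

(** * The moment functional of the measure *)

Section RealParts.
Context {R : realType}.
Local Notation C := R[i].
Implicit Types P Q : {poly C}.

Definition re_poly P : {poly R} := \poly_(i < size P) complex.Re P`_i.
Definition im_poly P : {poly R} := \poly_(i < size P) complex.Im P`_i.

Lemma ReD (z w : C) : complex.Re (z + w) = complex.Re z + complex.Re w.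
Proof. by case: z w => [a b] [c d]. Qed.

Lemma ImD (z w : C) : complex.Im (z + w) = complex.Im z + complex.Im w.
Proof. by case: z w => [a b] [c d]. Qed.

Lemma Re_horner P (x : R) : complex.Re P.[x%:C] = (re_poly P).[x].
Proof.
rewrite horner_poly horner_coef (big_morph _ ReD (erefl _ : complex.Re 0 = 0)).
apply: eq_bigr => i _; rewrite -rmorphXn /=.
by case: (P`_i) => a b; simpc.
Qed.

Lemma Im_horner P (x : R) : complex.Im P.[x%:C] = (im_poly P).[x].
Proof.
rewrite horner_poly horner_coef (big_morph _ ImD (erefl _ : complex.Im 0 = 0)).
apply: eq_bigr => i _; rewrite -rmorphXn /=.
by case: (P`_i) => a b; simpc.
Qed.

Lemma re_im_poly_eq0 P : re_poly P = 0 -> im_poly P = 0 -> P = 0.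
Proof.
move=> re0 im0; apply/polyP => i; rewrite coef0.
have [iP|Pi] := ltnP i (size P); last by rewrite nth_default.
have := congr1 (fun u : {poly R} => u`_i) re0.
have := congr1 (fun u : {poly R} => u`_i) im0.
by rewrite !coef_poly iP !coef0; case: (P`_i) => a b /= -> ->.
Qed.

Lemma horner_chebC n (x : R) :
  (cheb_nat n : {poly C}).[x%:C] = ((cheb_nat n : {poly R}).[x])%:C.
Proof.
have -> : (cheb_nat n : {poly C}) = map_poly (real_complex R) (cheb_nat n).
  have [] // : cheb_nat n = map_poly (real_complex R) (cheb_nat n) /\
    cheb2 n = map_poly (real_complex R) (cheb2 n).
  elim: n => [|n [IHt IHu]].
    by rewrite /cheb_nat /cheb2 /= rmorph1 rmorph0.
  rewrite !(cheb_natS, cheb2S) IHt IHu.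
  by rewrite !(rmorphB, rmorphD, rmorphM, rmorph1, rmorphXn) /= map_polyX.
by rewrite horner_map.
Qed.

End RealParts.

Section Functional.
Context {R : realType}.
Local Notation C := R[i].
Variable mu : {finite_measure set (measurableTypeR R) -> \bar R}.
Local Notation I := (`[(-1)%R, 1%R]%classic : set (measurableTypeR R)).

Definition mu_functional (P : {poly C}) : C :=
  cintegral mu `[(-1)%R, 1%R] (fun x => P.[x%:C]).

Lemma integrable_horner (f : {poly R}) :
  mu.-integrable I (EFin \o (fun x => f.[x])).
Proof.
apply: measurable_bounded_integrable.
- exact: measurable_itv.
- by rewrite -ge0_fin_numE // fin_num_measure //; exact: measurable_itv.
- exact: measurable_horner.
have [M M0 fM] := horner_bound f.
exists M; split; first exact: num_real.
by move=> y My x xI; apply: le_trans (fM x xI) (ltW My).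
Qed.

Lemma mu_functionalE P : mu_functional P =
  (\int[mu]_(x in I) (re_poly P).[x]) +i* (\int[mu]_(x in I) (im_poly P).[x]).
Proof.
by rewrite /mu_functional /cintegral; congr (_ +i* _); apply: eq_Rintegral => x _;
  rewrite ?Re_horner ?Im_horner.
Qed.

Lemma mu_functional_linear a P Q :
  mu_functional (a *: P + Q) = a * mu_functional P + mu_functional Q.
Proof.
have mI : measurable I by exact: measurable_itv.
have iZ k f : mu.-integrable I (EFin \o (fun x => k * f.[x])).
  have -> : (fun x => k * f.[x]) = (fun x => (k *: f).[x]).
    by apply/funext => x; rewrite hornerZ.
  exact: integrable_horner.
rewrite !mu_functionalE; case: a => a b; simpc.
have -> : (fun x => (re_poly ((a +i* b) *: P + Q)).[x]) =
   (fun x => a * (re_poly P).[x] - b * (im_poly P).[x] + (re_poly Q).[x]).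
  apply/funext => x; rewrite -!Re_horner -Im_horner hornerD hornerZ ReD.
  by case: (P.[_]) => c d; simpc.
have -> : (fun x => (im_poly ((a +i* b) *: P + Q)).[x]) =
   (fun x => a * (im_poly P).[x] + b * (re_poly P).[x] + (im_poly Q).[x]).
  apply/funext => x; rewrite -!Im_horner -Re_horner hornerD hornerZ ImD.
  by case: (P.[_]) => c d; simpc.
have iRe := integrable_horner (re_poly P).
have iIm := integrable_horner (im_poly P).
rewrite RintegralD //; last exact: integrable_horner.
  rewrite [in X in _ +i* X]RintegralD //; last exact: integrable_horner.
    rewrite RintegralB // RintegralD // !RintegralZl //.
  have -> : (fun x => a * (im_poly P).[x] + b * (re_poly P).[x]) =
      (fun x => (a *: im_poly P + b *: re_poly P).[x]).
    by apply/funext => x; rewrite hornerD !hornerZ.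
  exact: integrable_horner.
have -> : (fun x => a * (re_poly P).[x] - b * (im_poly P).[x]) =
    (fun x => (a *: re_poly P - b *: im_poly P).[x]).
  by apply/funext => x; rewrite hornerD hornerN !hornerZ.
exact: integrable_horner.
Qed.

Lemma mu_functional_real (P : {poly C}) (f : R -> R) :
  (forall x, x \in `[-1, 1] -> P.[x%:C] = (f x)%:C) ->
  mu_functional P = (\int[mu]_(x in I) f x)%:C.
Proof.
move=> Pf; rewrite /mu_functional /cintegral; congr (_ +i* _).
  by apply: eq_Rintegral => x /set_mem xI; rewrite Pf.
rewrite -[RHS](mul0r (fine (mu I))) -(Rintegral_cst mu (measurable_itv _)).
by apply: eq_Rintegral => x /set_mem xI; rewrite Pf.
Qed.

Lemma mu_functional_cheb_bound i : cmod (mu_functional (cheb i)) <= fine (mu I).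
Proof.
have mI : measurable I by exact: measurable_itv.
rewrite (@mu_functional_real _ (fun x => (cheb_nat `|i|%N).[x])); last first.
  by move=> x _; exact: horner_chebC.
rewrite cmodR; apply: le_trans (le_normr_Rintegral mI (integrable_horner _)) _.
rewrite -[leRHS]mul1r -(Rintegral_cst mu mI); apply: le_Rintegral => //.
- have := integrable_abse (integrable_horner (cheb_nat `|i|%N)); exact.
- exact: (finite_measure_integrable_cst _ 1).
- by move=> x xI; exact: cheb_bound.
Qed.

End Functional.

(** * The class of measures and the theorem *)

Section Class.
Context {R : realType}.
Local Notation C := R[i].
Variable mu : {finite_measure set (measurableTypeR R) -> \bar R}.
Local Notation I := (`[(-1)%R, 1%R]%classic : set (measurableTypeR R)).

Lemma poly_eq0_segment (P : {poly C}) :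
  (forall x : R, x \in `[-1, 1] -> P.[x%:C] = 0) -> P = 0.
Proof.
move=> P0; pose rs := [seq ((i.+1%:R : R)^-1)%:C | i <- iota 0 (size P)].
apply: (@roots_geq_poly_eq0 _ P rs); last by rewrite size_map size_iota.
  apply/allP => _ /mapP[i _ ->]; apply/rootP; apply: P0; rewrite in_itv /=.
  by rewrite invf_le1 // ler1n andbT (le_trans (lerN10 _)) // invr_ge0.
rewrite map_inj_uniq ?iota_uniq // => i j /complexI /invr_inj /eqP.
by rewrite eqr_nat eqSS => /eqP.
Qed.

Lemma chebyshev_class_real m : chebyshev_class m mu ->
  exists (r : C) (nu : 'I_m -> C) (p : {poly R}),
  [/\ r != 0, p != 0, forall x : R, x \in `[-1, 1] -> 0 <= p.[x],
      forall x : R, x \in `[-1, 1] ->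
        (r *: \prod_(i < m) ('X - (nu i)%:P)).[x%:C] = (p.[x])%:C
    & forall A : set (measurableTypeR R), measurable A ->
        mu A = (\int[chebyshev_measure]_(x in A `&` I) (p.[x]^-1)%:E)%E].
Proof.
case=> r [nu /= [r0 rho_ge0 muE]]; exists r, nu.
set rho := r *: _ in rho_ge0 muE *; exists (re_poly rho).
have rhoE (x : R) : x \in `[-1, 1] -> rho.[x%:C] = ((re_poly rho).[x])%:C.
  move=> xI; have := rho_ge0 x xI; rewrite -Re_horner.
  by case: (rho.[_]) => a b; rewrite lecE /= => /andP[/eqP -> _].
have rho0 : rho != 0.
  rewrite scaler_eq0 negb_or r0 /=; apply/prodf_neq0 => i _.
  by rewrite polyXsubC_eq0.
split=> //.
- apply: contra_neq rho0 => p0; apply: poly_eq0_segment => x xI.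
  by rewrite rhoE // p0 horner0.
- by move=> x xI; rewrite -ler0c -rhoE // rho_ge0.
- move=> A mA; rewrite muE //; apply: eq_integral => x /set_mem[_ xI].
  by rewrite rhoE // -fmorphV.
Qed.

(** The integrand is the sum of the squares of the real and imaginary parts of [P]. *)
Lemma mu_functional_definite (p : {poly R}) (P : {poly C}) : p != 0 ->
  (forall x : R, x \in `[-1, 1] -> 0 <= p.[x]) ->
  (forall A : set (measurableTypeR R), measurable A ->
     mu A = (\int[chebyshev_measure]_(x in A `&` I) (p.[x]^-1)%:E)%E) ->
  mu_functional mu (P * map_poly conjc P) = 0 -> P = 0.
Proof.
move=> p0 pge muE.
have mI : measurable I by exact: measurable_itv.
pose f := re_poly P ^+ 2 + im_poly P ^+ 2.
have fE x : f.[x] = (re_poly P).[x] ^+ 2 + (im_poly P).[x] ^+ 2.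
  by rewrite hornerD !horner_exp.
rewrite (@mu_functional_real _ _ _ (fun x => f.[x])); last first.
  move=> x _; rewrite hornerM fE -Re_horner -Im_horner.
  have -> : (map_poly conjc P).[x%:C] = (P.[x%:C])^*%C.
    by rewrite -[in LHS](conjc_real x) horner_map.
  by case: (P.[_]) => a b /=; simpc; congr (_ +i* _); ring.
case=> /eqP intf.
have {}intf : (\int[mu]_(x in I) (f.[x])%:E = 0)%E.
  rewrite -[LHS]fineK; last exact: integrable_fin_num (integrable_horner mu f).
  by congr EFin; apply/eqP.
have sq0 (g : {poly R}) : (forall x, g.[x] ^+ 2 <= f.[x]) -> g = 0.
  move=> gf; apply/eqP; rewrite -sqrf_eq0; apply/eqP.
  apply: (integral_poly_eq0 p0 pge muE) => [x _|].
    by rewrite horner_exp sqr_ge0.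
  apply/eqP; rewrite eq_le; apply/andP; split; last first.
    by apply: integral_ge0 => x _; rewrite lee_fin horner_exp sqr_ge0.
  rewrite -intf; apply: ge0_le_integral => //.
  - by move=> x _; rewrite lee_fin horner_exp sqr_ge0.
  - by apply/measurable_EFinP; exact: measurable_horner.
  - by apply/measurable_EFinP; exact: measurable_horner.
  - by move=> x _; rewrite lee_fin horner_exp.
apply: re_im_poly_eq0; apply: sq0 => x; rewrite fE.
  by rewrite lerDl sqr_ge0.
by rewrite lerDr sqr_ge0.
Qed.

(** Multiplication by [p] cancels the density [1 / p] and leaves the Chebyshev
measure. It is applied to the nonnegative [p (T_n + 1)] and [p]. *)
Lemma integral_weight_cheb (p : {poly R}) n : p != 0 ->
  (forall x : R, x \in `[-1, 1] -> 0 <= p.[x]) ->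
  (forall A : set (measurableTypeR R), measurable A ->
     mu A = (\int[chebyshev_measure]_(x in A `&` I) (p.[x]^-1)%:E)%E) ->
  (0 < n)%N -> \int[mu]_(x in I) (p.[x] * (cheb_nat n).[x]) = 0.
Proof.
move=> p0 pge muE n0; have mI : measurable I by exact: measurable_itv.
have pn0 x : x \in `[-1, 1] -> p.[x] != 0.
  by move=> xI; exact: (density_root_free p0 pge muE xI).
have E1 : (\int[mu]_(x in I) (p.[x] * ((cheb_nat n).[x] + 1))%:E =
    \int[@lebesgue_measure R]_(x in I)
      (((cheb_nat n).[x] + 1) * chebyshev_density x)%:E)%E.
  rewrite (integral_mu pge muE).
  - apply: eq_integral => x /set_mem xI; congr EFin; rewrite weightE //.
    by rewrite mulrACA mulfV ?mul1r ?pn0.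
  - apply: measurable_funM; first exact: measurable_horner.
    by apply: measurable_funD => //; exact: measurable_horner.
  - move=> x xI; rewrite mulr_ge0 ?pge //.
    by have := cheb_bound n xI; rewrite ler_norml => /andP[h _]; lra.
have E2 : (\int[mu]_(x in I) (p.[x])%:E =
    \int[@lebesgue_measure R]_(x in I) (chebyshev_density x)%:E)%E.
  rewrite (integral_mu pge muE) //; last exact: measurable_horner.
  apply: eq_integral => x /set_mem xI; congr EFin; rewrite weightE //.
  by rewrite mulrA mulfV ?mul1r ?pn0.
have -> : (fun x => p.[x] * (cheb_nat n).[x]) =
    (fun x => (p * (cheb_nat n + 1)).[x] - p.[x]).
  by apply/funext => x; rewrite hornerM hornerD hornerC mulrDr mulr1 addrK.
rewrite RintegralB //; try exact: integrable_horner.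
apply/eqP; rewrite subr_eq0; apply/eqP; rewrite /Rintegral; congr fine.
rewrite E2 -(integral_cheb_density n0) -E1; apply: eq_integral => x _.
by rewrite hornerM hornerD hornerC.
Qed.

(** The Bernstein-Szego description of the orthogonal polynomials: [s] lists the
numbers [a] inside the unit disk with [(a + a^-1) / 2] a zero of [rho]. *)
Lemma bernstein_szego m (mu_class : chebyshev_class m mu) :
  exists s : seq C,
    [/\ all (fun a => cmod a <= 1) s &
    forall n (P : {poly C}), (size s < n)%N -> size P = n.+1 ->
      (forall S : {poly C}, (size S <= n)%N -> mu_functional mu (P * S) = 0) ->
      exists2 c, c != 0 & P = c *: shift_prod (-1) s cheb n].
Proof.
have [r [nu [p [r0 p0 pge rhoE muE]]]] := chebyshev_class_real mu_class.
pose s := [seq (phi (nu i))^-1 | i <- enum 'I_m].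
have nuU i : ~ unit_segment (nu i).
  case=> x xI xnu; have /negP := density_root_free p0 pge muE xI; apply.
  apply/rootP/complexI; rewrite -rhoE // hornerZ horner_prod (bigD1 i) //=.
  by rewrite hornerXsubC xnu subrr mul0r mulr0.
have s1 : all (fun a => cmod a < 1) s.
  apply/allP => _ /mapP[i _ ->]; rewrite cmodV invf_lt1.
    exact: cmod_phi_gt1 (nuU i).
  by rewrite cmod_gt0 phi_neq0.
have s0 : all (predC1 0) s.
  by apply/allP => _ /mapP[i _ ->] /=; rewrite invr_eq0 phi_neq0.
have prodE : \prod_(a <- s) ('X - (joukowski a)%:P) =
    \prod_(i < m) ('X - (nu i)%:P).
  rewrite big_map big_enum /=; apply: eq_bigr => i _.
  by rewrite joukowskiV joukowski_phi.
exists s; split; first by apply: sub_all s1 => a; exact: ltW.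
move=> n P sn sP PS.
apply: (@orthogonal_poly_proportional _ (mu_functional mu) s (fine (mu I)) n P) => //.
- exact: mu_functional_linear.
- by move=> S; exact: mu_functional_definite p0 pge muE.
- exact: mu_functional_cheb_bound.
move=> j j0; apply: (mulfI r0); rewrite mulr0.
have <- : mu_functional mu
    (r *: (\prod_(a <- s) ('X - (joukowski a)%:P) * cheb_nat j)) =
    r * mu_functional mu (\prod_(a <- s) ('X - (joukowski a)%:P) * cheb_nat j).
  have L0 : mu_functional mu 0 = 0.
    have := mu_functional_linear mu (-1) 0 0.
    by rewrite scaler0 addr0 mulN1r addNr.
  by have := mu_functional_linear mu r
    (\prod_(a <- s) ('X - (joukowski a)%:P) * cheb_nat j) 0; rewrite L0 !addr0.
rewrite prodE scalerAl.
rewrite (@mu_functional_real _ _ _ (fun x => p.[x] * (cheb_nat j).[x])).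
  by rewrite integral_weight_cheb.
by move=> x xI; rewrite hornerM rhoE // horner_chebC rmorphM.
Qed.

End Class.

Lemma size_polar_op (R : realType) (zeta : R[i]) (Q : {poly R[i]}) n :
  size Q = n.+1 -> size (polar_op zeta Q) = n.+1.
Proof.
move=> sQ; rewrite polar_opE.
have Q0 : Q != 0 by rewrite -size_poly_eq0 sQ.
have sM : size (('X - zeta%:P) * Q) = n.+2.
  by rewrite mulrC size_Mmonic ?monicXsubC // size_XsubC sQ addn2.
rewrite /deriv sM size_poly_eq //= mulrn_eq0 /=.
have : lead_coef (('X - zeta%:P) * Q) != 0.
  by rewrite lead_coef_eq0 -size_poly_eq0 sM.
by rewrite lead_coefE sM.
Qed.

Theorem theorem22 (R : realType) (zeta : R[i]) (m : nat)
    (mu : {finite_measure set (measurableTypeR R) -> \bar R})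
    (Q : nat -> {poly R[i]}) :
  ~ unit_segment zeta ->
  chebyshev_class m mu ->
  (forall n : nat, size (Q n) = n.+1) ->
  (forall n : nat, polar_orthogonal zeta mu n (Q n)) ->
  zero_accumulation Q `<=` ellipse zeta `|` unit_segment /\
  (2 < dist_segment zeta -> zero_accumulation Q `<=` ellipse zeta).
Proof.
move=> zU mu_class sQ oQ.
suff sub : zero_accumulation Q `<=` ellipse zeta.
  by split=> [z /sub|_ //]; left.
have [s [s1 Hs]] := bernstein_szego mu_class.
apply: (accumulation_in_ellipse zU s1) => n sn.
apply: Hs => // [|S sS]; first exact: size_polar_op.
rewrite -(oQ n S sS); congr (cintegral mu _ _).
by apply/funext => x; rewrite hornerM.
Qed.
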